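(* There is an absolute constant $C>0$ such that for every $n$ and every tree $H\subseteq K_n$ with at least one edge, the uniform probability measure $\nu_H$ on the copies of $H$ in $K_n$ is $Cq_H$-spread.
   Context: All graphs are finite and simple; $e(G)$ is the number of edges of $G$. A graph is nonempty if it has at least one edge. Isolated vertices are omitted, so a subgraph is identified with its edge set together with the endpoints of these edges; subgraphs need not be induced or connected. A copy of $H$ in $K_n$ is a subgraph of $K_n$ isomorphic to $H$, and $N_I(G)$ denotes the number of copies of $I$ in $G$. $\nu_H$ is the uniform probability measure on the copies of $H$ in $K_n$. For nonempty $H\subseteq K_n$, $$q_H:=\max_{\varnothing\ne I\subseteq H}N_I(K_n)^{-1/e(I)},$$ the maximum being over all nonempty subgraphs $I$ of $H$. A probability measure $\mu$ on subgraphs of $K_n$ is $a$-spread if $\mu(\{S:A\subseteq E(S)\})\le a^{|A|}$ for every nonempty edge set $A\subseteq E(K_n)$. *)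

(* Defs.v *)
From HB Require Import structures.
From mathcomp Require Import all_boot all_order all_algebra.
From mathcomp Require Import reals exp.

Set Implicit Arguments.
Unset Strict Implicit.
Unset Printing Implicit Defensive.

Import Order.TTheory GRing.Theory Num.Theory.
Local Open Scope ring_scope.

(* The edges of K_n. Isolated vertices are omitted, so a subgraph of K_n is
   an edge set, and every element of [graph n] is a subgraph of K_n. *)
Definition edge (n : nat) := {e : {set 'I_n} | #|e| == 2}.
Definition graph (n : nat) := {set edge n}.

Definition Kn (n : nat) : graph n := [set: edge n].

Definition vertices n (G : graph n) : {set 'I_n} :=
  (\bigcup_(e in G) val e).

Definition adj n (G : graph n) : rel 'I_n :=
  fun u v => [exists e in G, val e == [set u; v]].

(* The values of f outside [vertices G] are irrelevant. *)
Definition is_iso n (G H : graph n) (f : {ffun 'I_n -> 'I_n}) : bool :=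
  [&& dinjectiveb f (mem (vertices G)),
      (f @: vertices G) == vertices H
    & [forall u in vertices G, forall v in vertices G,
         adj G u v == adj H (f u) (f v)]].

Definition isomorphic n (G H : graph n) : bool :=
  [exists f : {ffun 'I_n -> 'I_n}, is_iso G H f].

Definition copies n (I G : graph n) : {set graph n} :=
  [set J : graph n | (J \subset G) && isomorphic I J].

Definition N n (I G : graph n) : nat := #|copies I G|.

Definition connected_graph n (G : graph n) : Prop :=
  {in vertices G &, forall u v, connect (adj G) u v}.

Definition acyclic n (G : graph n) : Prop :=
  forall c : seq 'I_n, (2 < size c)%N -> ~~ ucycleb (adj G) c.

Definition is_tree n (G : graph n) : Prop :=
  connected_graph G /\ acyclic G.

(* All the terms are positive, so for a nonempty H the default value 0 does
   not affect the maximum. *)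
Definition q (R : realType) n (H : graph n) : R :=
  \big[Num.max/0]_(I : graph n | (I != set0) && (I \subset H))
    (N I (Kn n))%:R `^ (- #|I|%:R^-1).

(* A probability measure on a finite type, given by its point masses. *)
Record prob_measure (R : realType) (T : finType) := ProbMeasure {
  mass :> {ffun T -> R};
  mass_ge0 : forall x, 0 <= mass x;
  mass_sum1 : \sum_x mass x = 1
}.

Definition pr (R : realType) (T : finType) (mu : prob_measure R T)
    (E : {set T}) : R :=
  \sum_(x in E) mu x.

Definition spread (R : realType) n (a : R)
    (mu : prob_measure R (graph n)) : Prop :=
  forall A : {set edge n}, A != set0 ->
    pr mu [set S : graph n | A \subset S] <= a ^+ #|A|.

Section Uniform.
Variables (R : realType) (T : finType) (X : {set T}) (x0 : T).
Hypothesis Xx0 : x0 \in X.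

Definition uniform_mass : {ffun T -> R} :=
  [ffun x => if x \in X then #|X|%:R^-1 else 0].

Lemma uniform_mass_ge0 x : 0 <= uniform_mass x.
Proof. by rewrite ffunE; case: ifP => // _; rewrite invr_ge0 ler0n. Qed.

Lemma uniform_mass_sum1 : \sum_x uniform_mass x = 1.
Proof.
under eq_bigr do rewrite ffunE.
rewrite -big_mkcond sumr_const -[X in X = 1]mulr_natr mulVf //.
by rewrite pnatr_eq0 -lt0n; apply/card_gt0P; exists x0.
Qed.

Definition uniform : prob_measure R T :=
  ProbMeasure uniform_mass_ge0 uniform_mass_sum1.
End Uniform.

Lemma isomorphic_refl n (G : graph n) : isomorphic G G.
Proof.
apply/existsP; exists [ffun x => x]; apply/and3P; split.
- by apply/dinjectiveP => x y _ _; rewrite !ffunE.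
- by apply/eqP; rewrite -[RHS]imset_id; apply: eq_imset => x; rewrite ffunE.
- by apply/forall_inP => u _; apply/forall_inP => v _; rewrite !ffunE.
Qed.

Lemma mem_copies n (H : graph n) : H \in copies H (Kn n).
Proof. by rewrite inE subsetT isomorphic_refl. Qed.

Definition nu (R : realType) n (H : graph n) : prob_measure R (graph n) :=
  uniform R (mem_copies H).

(* Main.v *)
Require Import Defs.
From HB Require Import structures.
From mathcomp Require Import all_boot all_order all_algebra.
From mathcomp Require Import reals exp.
From mathcomp Require Import fingroup perm boolp.
From mathcomp Require Import zify ring lra.

Set Implicit Arguments.
Unset Strict Implicit.
Unset Printing Implicit Defensive.

Import Order.TTheory GRing.Theory Num.Theory.
Local Open Scope ring_scope.

(* Write p = 8nq, up to constants the threshold rescaled by n.  A copy of H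
   contains A exactly when the inverse of a uniform permutation embeds A in H,
   so it suffices to show, for each component T of A with t edges, that T has
   at most n (Cp)^t embeddings in H.

   Lower bounds on q come from forests F in H with c components and e edges.
   Coding a copy of F by its child sets in depth-first order shows that F has at
   most C^e n^(c+e) / (c! prod_v d(v)!) copies, d(v) being the number of children
   of v; since each copy count is at least q^(-e), this gives
   c! prod_v d(v)! <= n^c p^e.  Hence, for the weight
   w(J) = prod_v d(v)! / (4p)^e(J) of a rooted subtree J, a maximal disjoint
   family of subtrees of weight at least x covers a set U_x of at most 2n/x
   vertices.

   Pointwise, if all subtrees rooted at v have weight at most M >= 1, then T has
   at most (Cp)^t damp(M) embeddings with its root at v, where
   damp(M) = M / (1 + ln(M)/2)^2: this is an induction on T in which the children
   of v are ranked by their best weight.  The logarithmic saving in damp makes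
   the level-set sum converge: classifying the embeddings of T by the last
   U_(2^j) that they meet gives n (Cp)^t sum_j damp(2^(j+1)) / 2^j = O(n (Cp)^t).
   All this needs 4p >= 1; for small p one compares with a spanning tree of H. *)

(** * Real and combinatorial estimates *)

Section NatEstimates.
Local Open Scope nat_scope.

Lemma expn_le_ffact_mul m k : m ^ k <= (m + k) ^_ k.
Proof.
elim: k m => [|k IHk] m; first by rewrite ffactn0.
by rewrite addnS ffactSS expnS leq_mul ?IHk // leqW ?leq_addr.
Qed.

(** A crude Stirling bound: [m ^ k <= (m + k) ^_ k], and the latter is k! times a binomial
    coefficient of size at most [2 ^ (m + k)]. *)
Lemma expn_le_fact_mul4 m k : k <= m -> m ^ k <= k`! * 4 ^ m.
Proof.
move=> le_km; apply: leq_trans (expn_le_ffact_mul m k) _.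
rewrite -bin_ffact mulnC leq_mul2l; apply/orP; right.
have: 'C(m + k, k) <= 2 ^ (m + k).
  rewrite -[2]/(1 + 1) expnDn.
  have lt_k : k < (m + k).+1 by rewrite ltnS leq_addl.
  by rewrite (bigD1 (Ordinal lt_k)) //= !exp1n !muln1 leq_addr.
move/leq_trans; apply; rewrite -[4]/(2 ^ 2) -expnM leq_exp2l //.
by rewrite mul2n -addnn leq_add2l.
Qed.

Lemma ffact_leq_expn n k : n ^_ k <= n ^ k.
Proof.
by elim: k => // k IHk; rewrite ffactnSr expnSr leq_mul // leq_subr.
Qed.

(* Factor by factor, [(n - k) / n >= (v - k) / v]. *)
Lemma expn_mul_fact_le n v : v <= n -> n ^ v * v`! <= v ^ v * n ^_ v.
Proof.
move=> le_vn.
suff H k : k <= v -> n ^ k * v ^_ k <= v ^ k * n ^_ k.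
  by have := H v (leqnn v); rewrite ffactnn.
elim: k => [|k IHk] le_kv; first by rewrite !ffactn0.
rewrite !expnSr !ffactnSr mulnACA [v ^ k * v * _]mulnACA.
apply: leq_mul; first exact/IHk/ltnW.
by rewrite !mulnBr [v * n]mulnC leq_sub2l // leq_mul2r le_vn orbT.
Qed.

(** The loss v^v / v! of the previous lemma is at most [4 ^ v]. This finally trades n! / (n - v)!
    for a power of [n]. *)
Lemma expn_le_ffact4 n v : v <= n -> n ^ v <= 4 ^ v * n ^_ v.
Proof.
move=> le_vn; have v_gt0 : 0 < v`! by rewrite fact_gt0.
rewrite -(leq_pmul2r v_gt0); apply: leq_trans (expn_mul_fact_le le_vn) _.
have := expn_le_fact_mul4 (leqnn v).
by rewrite -(leq_pmul2r (_ : 0 < n ^_ v)) ?ffact_gt0 // => /leq_trans; apply; lia.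
Qed.

End NatEstimates.

(** * The damping function and its sum over ranks *)

Section Damping.
Variable R : realType.
Implicit Types x y : R.

(* [damp y / y] is summable over powers of 2, so that a weak-type bound can be
   summed, while [damp] stays supermultiplicative. *)
Definition damp y : R := y / (1 + ln y / 2) ^+ 2.

Lemma damp_den_gt0 y : 1 <= y -> 0 < 1 + ln y / 2.
Proof. by move=> /ln_ge0; lra. Qed.

Lemma damp_den_sqr_gt0 y : 1 <= y -> 0 < (1 + ln y / 2) ^+ 2.
Proof. by move=> y1; rewrite exprn_gt0 // damp_den_gt0. Qed.

(** The inequality [1 + t <= exp t] at [t = ln y / 2] bounds the denominator by [y]; this is why the
    logarithm is halved. *)
Lemma damp_ge1 y : 1 <= y -> 1 <= damp y.
Proof.
move=> y1; rewrite /damp ler_pdivlMr ?damp_den_sqr_gt0 // mul1r.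
have y0 : 0 < y by exact: lt_le_trans y1.
rewrite [leRHS](_ : y = sequences.expR (ln y / 2) ^+ 2); last first.
  by rewrite expr2 -expRD -splitr lnK.
rewrite lerXn2r ?nnegrE ?expR_ge0 ?(ltW (damp_den_gt0 y1)) //.
exact: expR_ge1Dx.
Qed.

Lemma damp_gt0 y : 1 <= y -> 0 < damp y.
Proof. by move=> /damp_ge1; apply: lt_le_trans. Qed.

(** For [a = ln x] and [b = ln y], both nonnegative, [(1 + a / 2) * (1 + b / 2)] is at least
    [1 + (a + b) / 2]. *)
Lemma damp_super x y : 1 <= x -> 1 <= y -> damp x * damp y <= damp (x * y).
Proof.
move=> x1 y1; have x0 : 0 < x by exact: lt_le_trans x1.
have y0 : 0 < y by exact: lt_le_trans y1.
rewrite /damp mulrACA -invfM ler_pM2l ?mulr_gt0 //.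
rewrite lef_pV2 ?posrE ?damp_den_sqr_gt0 ?mulr_ege1 //; last first.
  by rewrite mulr_gt0 ?damp_den_sqr_gt0.
rewrite -exprMn lnM ?posrE //.
have a0 := ln_ge0 x1; have b0 := ln_ge0 y1.
by rewrite lerXn2r ?nnegrE //; nra.
Qed.

(** No calculus is involved: [damp x <= damp x * damp (y / x) <= damp y]. *)
Lemma damp_le x y : 1 <= x -> x <= y -> damp x <= damp y.
Proof.
move=> x1 xy; have x0 : 0 < x by exact: lt_le_trans x1.
have q1 : 1 <= y / x by rewrite ler_pdivlMr // mul1r.
have := damp_super x1 q1; rewrite [x * _]mulrC divfK ?gt_eqF //; apply: le_trans.
by rewrite ler_peMr ?damp_ge1 // ltW // damp_gt0.
Qed.

(** Discrete form of a derivative: the left side is twice the derivative of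
    [1 / (1 + ln (X / z) / 2)] in [z] at [z = i + 2], and the constant 4 also pays for passing to a
    difference. *)
Lemma inv_damp_telescope (X : R) (i : nat) : i.+2%:R <= X ->
  (i.+2%:R)^-1 * (1 + ln (X / i.+2%:R) / 2)^-1 ^+ 2 <=
  4 * ((1 + ln (X / i.+2%:R) / 2)^-1 - (1 + ln (X / i.+1%:R) / 2)^-1).
Proof.
move=> iX; move: iX; set j : R := i.+2%:R; set k : R := i.+1%:R => iX.
have k1 : 1 <= k by rewrite ler1n.
have jk : j = k + 1 by rewrite /j /k -natr1.
clearbody j k.
have X0 : 0 < X by lra.
have a0 : 0 <= ln (X / j) by rewrite ln_ge0 // ler_pdivlMr ?mul1r //; lra.
have lnE : ln (X / k) = ln (X / j) + ln (j / k).
  rewrite -lnM ?posrE ?divr_gt0 //; try lra.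
  by congr ln; field; apply/andP; split; apply: lt0r_neq0; lra.
have l1 : ln (j / k) <= 1.
  have -> : j / k = 1 + k^-1 by rewrite jk; field; apply: lt0r_neq0; lra.
  have k0 : 0 < k^-1 by rewrite invr_gt0; lra.
  by apply: le_trans (le_ln1Dx _) _; rewrite ?invf_le1; lra.
have l2 : j^-1 <= ln (j / k).
  have -> : ln (j / k) = - ln (1 + - j^-1).
    rewrite -lnV ?posrE; last by rewrite subr_gt0 invf_lt1; lra.
    congr ln; rewrite jk; field; apply/andP; split; [|by apply: lt0r_neq0; lra].
    by apply: lt0r_neq0; lra.
  rewrite lerNr; apply: le_ln1Dx; rewrite ltrNr opprK invf_lt1; lra.
rewrite lnE; set a := ln (X / j) in a0 *; set l := ln (j / k) in l1 l2 *.
have l0 : 0 <= l by apply: le_trans l2; rewrite invr_ge0; lra.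
have -> : (1 + a / 2)^-1 - (1 + (a + l) / 2)^-1 =
    (l / 2) * ((1 + a / 2)^-1 * (1 + (a + l) / 2)^-1).
  by field; apply/andP; split; apply: lt0r_neq0; lra.
have b0 : 0 < (1 + a / 2)^-1 by rewrite invr_gt0; lra.
(* As [l <= 1], one step at most doubles the denominator. *)
have b1 : (1 + a / 2)^-1 <= 2 * (1 + (a + l) / 2)^-1.
  by rewrite -[2]invrK -invfM lef_pV2 ?posrE ?mulr_gt0; lra.
move: b0 b1; set A := (1 + a / 2)^-1; set B := (1 + (a + l) / 2)^-1 => A0 AB.
apply: le_trans (_ : l * (A * (2 * B)) <= _); last by lra.
rewrite expr2; apply: ler_pM => //; last by rewrite ler_pM2l.
- by rewrite invr_ge0; lra.
- by rewrite mulr_ge0 ?ltW.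
Qed.

Lemma sum_inv_damp_le4 (X : R) (d : nat) : d%:R <= X ->
  \sum_(i < d) (i.+1%:R)^-1 * (1 + ln (X / i.+1%:R) / 2)^-1 ^+ 2 <= 4.
Proof.
case: d => [|d] dX; first by rewrite big_ord0.
have pos i : i.+1%:R <= X -> 0 < 1 + ln (X / i.+1%:R) / 2.
  by move=> iX; apply: damp_den_gt0; rewrite ler_pdivlMr ?ltr0n // mul1r.
suff H : \sum_(i < d.+1) (i.+1%:R)^-1 * (1 + ln (X / i.+1%:R) / 2)^-1 ^+ 2 <=
         4 * (1 + ln (X / d.+1%:R) / 2)^-1.
  apply: le_trans H _; rewrite ger_pMr // invf_le1 ?pos //.
  have : 0 <= ln (X / d.+1%:R) by rewrite ln_ge0 // ler_pdivlMr ?ltr0n // mul1r.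
  lra.
(* The telescoping starts with the second term; the first one is bounded directly. *)
elim: d dX => [|d IHd] dX.
  have := pos 0%N dX; have : 0 <= ln (X / 1%:R) by rewrite ln_ge0 // divr1.
  rewrite big_ord_recl big_ord0 addr0 invr1 mul1r expr2.
  set c := 1 + _ => l0 c0; apply: ler_wpM2r; first by rewrite invr_ge0 ltW.
  by apply: le_trans (_ : 1 <= _); rewrite ?invf_le1 // /c; lra.
rewrite big_ord_recr /=; have dX' : d.+1%:R <= X.
  by apply: le_trans dX; rewrite ler_nat.
apply: le_trans (lerD (IHd dX') (inv_damp_telescope dX)) _.
by rewrite -mulrDr addrCA subrr addr0.
Qed.

End Damping.

(** * Labelled forests *)

(* [Cons v k s] is the tree with root [v] whose children are the trees of [k],
   followed by the trees of [s]. *)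
Inductive forest (V : Type) : Type :=
  Nil | Cons of V & forest V & forest V.
Arguments Nil {V}.

HB.instance Definition _ (V : Type) := gen_eqMixin (forest V).

Fixpoint labels V (F : forest V) : seq V :=
  if F is Cons v k s then v :: labels k ++ labels s else [::].

Fixpoint roots V (F : forest V) : seq V :=
  if F is Cons v k s then v :: roots s else [::].

(* Orderings of the children of every vertex; [gfac] also orders the roots. *)
Fixpoint fac V (F : forest V) : nat :=
  if F is Cons v k s then ((size (roots k))`! * fac k * fac s)%N else 1%N.

Definition gfac V (F : forest V) : nat := ((size (roots F))`! * fac F)%N.

Fixpoint pairs V (v : V) (F : forest V) : seq (V * V) :=
  if F is Cons u k s then (v, u) :: pairs u k ++ pairs v s else [::].

Fixpoint tpairs V (F : forest V) : seq (V * V) :=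
  if F is Cons v k s then pairs v k ++ tpairs s else [::].

Fixpoint fmap V W (f : V -> W) (F : forest V) : forest W :=
  if F is Cons v k s then Cons (f v) (fmap f k) (fmap f s) else Nil.

(** Forests as lists of rooted trees, a form in which siblings can be permuted or indexed by a
    finite set. *)
Definition mk V (s : seq (V * forest V)) : forest V :=
  foldr (fun p => Cons p.1 p.2) Nil s.

Fixpoint unmk V (F : forest V) : seq (V * forest V) :=
  if F is Cons v k s then (v, k) :: unmk s else [::].

(** [P] constrains only the roots: [P = e v] makes [F] hang below [v], while [predT] leaves it
    free. *)
Fixpoint valid V (e : rel V) (P : pred V) (F : forest V) : bool :=
  if F is Cons v k s then [&& P v, valid e (e v) k & valid e P s] else true.

Section ForestTheory.
Variable V : eqType.
Implicit Types (F k s : forest V) (l : seq (V * forest V)).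
Local Open Scope nat_scope.

Lemma unmkK F : mk (unmk F) = F.
Proof. by elim: F => //= v k _ s ->. Qed.

Lemma labels_mk l : labels (mk l) = flatten [seq p.1 :: labels p.2 | p <- l].
Proof. by elim: l => //= -[v k] l ->. Qed.

Lemma roots_mk l : roots (mk l) = map fst l.
Proof. by elim: l => //= -[v k] l ->. Qed.

Lemma fac_mk l : fac (mk l) = \prod_(p <- l) gfac p.2.
Proof. by elim: l => [|[v k] l IHl]; rewrite ?big_nil ?big_cons //= IHl. Qed.

Lemma pairs_mk v l :
  pairs v (mk l) = flatten [seq (v, p.1) :: pairs p.1 p.2 | p <- l].
Proof. by elim: l => //= -[u k] l ->. Qed.

Lemma tpairs_mk l : tpairs (mk l) = flatten [seq pairs p.1 p.2 | p <- l].
Proof. by elim: l => //= -[u k] l ->. Qed.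

Lemma valid_mk e P l :
  valid e P (mk l) = all (fun p => P p.1 && valid e (e p.1) p.2) l.
Proof. by elim: l => //= -[v k] l ->; rewrite andbA. Qed.

Lemma size_labels_mk l :
  size (labels (mk l)) = \sum_(p <- l) (size (labels p.2)).+1.
Proof.
by elim: l => [|[v k] l IHl]; rewrite ?big_nil ?big_cons //= size_cat IHl.
Qed.

Lemma fac_gt0 F : 0 < fac F.
Proof. by elim: F => //= v k IHk s IHs; rewrite !muln_gt0 fact_gt0 IHk. Qed.

Lemma gfac_gt0 F : 0 < gfac F.
Proof. by rewrite muln_gt0 fact_gt0 fac_gt0. Qed.

Lemma labels_fmap (W : Type) (f : V -> W) F : labels (fmap f F) = map f (labels F).
Proof. by elim: F => //= v k IHk s IHs; rewrite IHk IHs map_cat. Qed.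

Lemma roots_fmap (W : Type) (f : V -> W) F : roots (fmap f F) = map f (roots F).
Proof. by elim: F => //= v k IHk s IHs; rewrite IHs. Qed.

Lemma fac_fmap (W : Type) (f : V -> W) F : fac (fmap f F) = fac F.
Proof. by elim: F => //= v k IHk s IHs; rewrite IHk IHs roots_fmap size_map. Qed.

Lemma pairs_fmap (W : Type) (f : V -> W) v F :
  pairs (f v) (fmap f F) = [seq (f p.1, f p.2) | p <- pairs v F].
Proof. by elim: F v => //= u k IHk s IHs v; rewrite IHk IHs map_cat. Qed.

Lemma tpairs_fmap (W : Type) (f : V -> W) F :
  tpairs (fmap f F) = [seq (f p.1, f p.2) | p <- tpairs F].
Proof. by elim: F => //= v k _ s IHs; rewrite map_cat pairs_fmap IHs. Qed.

Lemma valid_fmap (W : Type) (f : V -> W) (e : rel V) (e' : rel W) (P : pred V) (P' : pred W) F :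
  (forall x y, e x y -> e' (f x) (f y)) -> (forall x, P x -> P' (f x)) ->
  valid e P F -> valid e' P' (fmap f F).
Proof.
move=> ee'; elim: F P P' => //= v k IHk s IHs P P' PP' /and3P[Pv vk vs].
by apply/and3P; split; [exact: PP' | exact: (IHk _ _ (ee' v)) | exact: (IHs P)].
Qed.

Lemma size_pairs v F : size (pairs v F) = size (labels F).
Proof. by elim: F v => //= u k IHk s IHs v; rewrite !size_cat IHk IHs. Qed.

Lemma size_tpairs F : size (tpairs F) + size (roots F) = size (labels F).
Proof.
by elim: F => //= v k _ s IHs; rewrite !size_cat -IHs size_pairs addnS addnA.
Qed.

Lemma map_snd_pairs v F : map snd (pairs v F) = labels F.
Proof. by elim: F v => //= u k IHk s IHs v; rewrite map_cat IHk IHs. Qed.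

Lemma pairs_sub v F p : p \in pairs v F ->
  p.1 \in v :: labels F /\ p.2 \in labels F.
Proof.
elim: F v => //= u k IHk s IHs v.
rewrite [p \in _]in_cons [p \in _ ++ _]mem_cat.
case/or3P=> [/eqP->|/IHk[h1 h2]|/IHs[h1 h2]].
- by rewrite /= !inE !eqxx.
- rewrite !in_cons !mem_cat h2 !orbT; split=> //.
  by move: h1; rewrite inE => /orP[]->; rewrite ?orbT.
- rewrite !in_cons !mem_cat h2 !orbT; split=> //.
  by move: h1; rewrite inE => /orP[]->; rewrite ?orbT.
Qed.

Lemma tpairs_sub F p : p \in tpairs F -> p.1 \in labels F /\ p.2 \in labels F.
Proof.
elim: F => //= v k _ s IHs; rewrite mem_cat => /orP[/pairs_sub[h1 h2]|/IHs[h1 h2]].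
  rewrite !inE !mem_cat h2 /= !orbT; move: h1; rewrite inE => /orP[]-> //.
  by rewrite orbT.
by rewrite !inE !mem_cat h1 h2 !orbT.
Qed.

(** Ensures that forgetting directions identifies no two edges. As the labels are distinct, two
    mutually reversed pairs would have to lie both in the branch of [u] or both among its later
    siblings, where induction applies. *)
Lemma pairs_antisym v F a b : uniq (v :: labels F) ->
  (a, b) \in pairs v F -> (b, a) \notin pairs v F.
Proof.
elim: F v => //= u k IHk s IHs v U H; apply/negP => H'; move: U.
rewrite inE !mem_cat !negb_or => /and3P[/and3P[vu vk vs] /andP[uk us]].
rewrite cat_uniq => /and3P[Uk ks Us].
have dis x : x \in labels k -> x \notin labels s.
  by move=> xk; apply: contraNN ks => xs; apply/hasP; exists x.
have U1 : uniq (u :: labels k) by rewrite /= uk.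
have U2 : uniq (v :: labels s) by rewrite /= vs.
move: H H'; rewrite !in_cons !mem_cat => H H'.
have sep x y x' y' : (x, y) \in pairs u k -> (x', y') \in pairs v s -> x = y' -> False.
  move=> /pairs_sub[/= h1 _] /pairs_sub[/= _ h2] E; move: h1; rewrite E inE.
  case/orP=> [/eqP E'|/dis]; last by rewrite h2.
  by rewrite -E' h2 in us.
have nv x y : (x, y) \in pairs u k -> (x != v) && (y != v).
  move=> /pairs_sub[/=]; rewrite inE => h1 h2; apply/andP; split.
    case/orP: h1 => [/eqP->|h1]; first by rewrite eq_sym.
    by apply: contraNneq vk => <-.
  by apply: contraNneq vk => <-.
have nv2 x y : (x, y) \in pairs v s -> y != v.
  by move=> /pairs_sub[/= _ h]; apply: contraNneq vs => <-.
case/or3P: H => [/eqP[ea eb]|H|H]; case/or3P: H' => [/eqP[eb' ea']|H'|H'].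
- by rewrite -ea ea' eqxx in vu.
- by have := nv _ _ H'; rewrite ea eqxx andbF.
- by have := nv2 _ _ H'; rewrite ea eqxx.
- by have := nv _ _ H; rewrite eb' eqxx andbF.
- by have := IHk _ U1 H; rewrite H'.
- exact: sep H H' erefl.
- by have := nv2 _ _ H; rewrite eb' eqxx.
- exact: sep H' H erefl.
- by have := IHs _ U2 H; rewrite H'.
Qed.

Lemma tpairs_antisym F a b : uniq (labels F) ->
  (a, b) \in tpairs F -> (b, a) \notin tpairs F.
Proof.
elim: F => //= v k _ s IHs /andP[]; rewrite mem_cat => /norP[vk vs].
rewrite cat_uniq => /and3P[Uk ks Us].
have dis x : x \in v :: labels k -> x \notin labels s.
  rewrite inE => /orP[/eqP->//|xk].
  by apply: contraNN ks => xs; apply/hasP; exists x.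
rewrite !mem_cat => /orP[] H; rewrite negb_or.
  rewrite pairs_antisym //= ?vk //; apply/negP => /tpairs_sub[_ /=].
  by have [/= /dis/negbTE->] := pairs_sub H.
rewrite IHs // andbT; apply/negP => /pairs_sub[/= /dis].
by have [_ /= ->] := tpairs_sub H.
Qed.

Lemma uniq_tpairs F : uniq (labels F) -> uniq (map snd (tpairs F)).
Proof.
suff: subseq (map snd (tpairs F)) (labels F) by apply: subseq_uniq.
elim: F => //= v k _ s IHs; rewrite map_cat map_snd_pairs.
exact: subseq_trans (cat_subseq (subseq_refl _) IHs) (subseq_cons _ _).
Qed.

Lemma valid_pairs (e : rel V) v F a b :
  valid e (e v) F -> (a, b) \in pairs v F -> e a b.
Proof.
elim: F v => //= u k IHk s IHs v /and3P[evu vk vs].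
by rewrite inE mem_cat => /or3P[/eqP[-> ->]|/(IHk _ vk)|/(IHs _ vs)].
Qed.

Lemma valid_tpairs (e : rel V) P F a b :
  valid e P F -> (a, b) \in tpairs F -> e a b.
Proof.
elim: F => //= u k _ s IHs /and3P[_ vk vs].
by rewrite mem_cat => /orP[/(valid_pairs vk)|/(IHs vs)].
Qed.

(** No root is isolated: then the edges determine all labels, and there are at most twice as many
    labels as edges. *)
Definition nontrivial F := all (fun p => size (labels p.2) > 0) (unmk F).

Lemma nontrivial_cover F x : nontrivial F -> x \in labels F ->
  exists2 p, p \in tpairs F & (x == p.1) || (x == p.2).
Proof.
elim: F => //= v k _ s IHs /andP[/= nk /IHs{}IHs].
rewrite inE mem_cat => /or3P[/eqP->|xk|/IHs[p ps px]]; last first.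
- by exists p; rewrite // mem_cat ps orbT.
- move: xk; rewrite -(map_snd_pairs v) => /mapP[p pk ->].
  by exists p; rewrite ?eqxx ?orbT // mem_cat pk.
- case: k nk => //= u k k' _; exists (v, u); rewrite ?eqxx //.
  by rewrite inE eqxx.
Qed.

Lemma nontrivial_size F : nontrivial F ->
  size (labels F) <= (size (tpairs F)).*2.
Proof.
elim: F => //= v k _ s IHs /andP[/= nk /IHs{}IHs].
by rewrite !size_cat size_pairs doubleD; move: nk IHs; rewrite -!muln2; lia.
Qed.

(** Serves to list siblings in the order of [enum], which the decoder uses. *)
Lemma mk_perm l r : perm_eq (map fst l) r ->
  exists2 l', perm_eq l l' & map fst l' = r.
Proof.
elim: r l => [|v r IHr] l pl.
  by exists [::]; case: l pl => // p l /perm_nilP.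
have /mapP[[u k] uk /= uv] : v \in map fst l by rewrite (perm_mem pl) mem_head.
subst u; have pl1 := perm_to_rem uk.
have [l' pl' <-] : exists2 l', perm_eq (rem (v, k) l) l' & map fst l' = r.
  by apply: IHr; rewrite -(perm_cons v) -(permPr pl) perm_sym (perm_map fst pl1).
by exists ((v, k) :: l') => //; rewrite (permPl pl1) perm_cons.
Qed.

End ForestTheory.

(** * Embedding forests into an acyclic graph *)

Lemma uniq_flatten_map (T U : eqType) (g : T -> seq U) (s : seq T) :
  uniq s -> {in s, forall u, uniq (g u)} ->
  (forall u w x, u \in s -> w \in s -> x \in g u -> x \in g w -> u = w) ->
  uniq (flatten (map g s)).
Proof.
elim: s => //= u s IHs /andP[us Us] Ug dis; rewrite cat_uniq.
rewrite Ug ?mem_head //= IHs // ?andbT; first last.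
- by move=> a b x sa sb; apply: dis; rewrite inE ?sa ?sb orbT.
- by move=> a sa; rewrite Ug // inE sa orbT.
apply/hasPn => x /flatten_mapP[w ws xw]; apply/negP => /= xu.
have uw : u = w by apply: (dis u w x); rewrite ?inE ?eqxx ?ws ?orbT.
by rewrite uw ws in us.
Qed.

Section Embeddings.
Variables (V : finType) (e : rel V).
Local Open Scope nat_scope.
Implicit Types (v u : V) (Y : {set V}) (K : forest V).

(* The value sequences of maps sending [F], placed below [v], into the graph [e]
   while avoiding [Y]; only siblings and ancestors are kept distinct. *)
Fixpoint emb W (F : forest W) v Y : seq (seq V) :=
  if F is Cons _ k s then
    flatten [seq [seq u :: l1 ++ l2 | l1 <- emb k u (u |: Y),
                                      l2 <- emb s v (u |: Y)]
            | u <- enum [set u | e v u & u \notin Y]]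
  else [:: [::]].

Definition cnt W (F : forest W) v Y : nat := size (emb F v Y).

Lemma cnt_nil W v Y : cnt (@Nil W) v Y = 1.
Proof. by []. Qed.

Lemma cnt_cons W (x : W) k s v Y : cnt (Cons x k s) v Y =
  \sum_(u in [set u | e v u & u \notin Y]) cnt k u (u |: Y) * cnt s v (u |: Y).
Proof.
rewrite /cnt /= size_flatten /shape sumnE !big_map big_enum /=.
by apply: eq_bigr => u _; rewrite size_allpairs.
Qed.

Lemma mem_emb W (f : W -> V) F v Y :
    valid e (e v) (fmap f F) -> uniq (labels (fmap f F)) ->
    {in labels (fmap f F), forall x, x \notin Y} ->
  labels (fmap f F) \in emb F v Y.
Proof.
elim: F v Y => //= x k IHk s IHs v Y /and3P[evx vk vs].
rewrite mem_cat negb_or => /andP[/andP[xk xs]].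
rewrite cat_uniq => /and3P[Uk ks Us] aY.
apply/flatten_mapP; exists (f x).
  by rewrite mem_enum inE evx aY // mem_head.
apply/allpairsP; exists (labels (fmap f k), labels (fmap f s)); split=> //.
- apply: IHk => // y yk; rewrite inE negb_or aY ?inE ?mem_cat ?yk ?orbT // andbT.
  by apply: contraNneq xk => <-.
- apply: IHs => // y ys; rewrite inE negb_or aY ?inE ?mem_cat ?ys ?orbT // andbT.
  by apply: contraNneq xs => <-.
Qed.

Lemma cnt_anti W (F : forest W) v Y Y' : Y \subset Y' -> cnt F v Y' <= cnt F v Y.
Proof.
elim: F v Y Y' => // x k IHk s IHs v Y Y' YY'; rewrite !cnt_cons.
have YuY' u : u |: Y \subset u |: Y' by apply: setUS.
rewrite [leqLHS]big_mkcond [leqRHS]big_mkcond /=; apply: leq_sum => u _.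
rewrite !inE; case: (e v u) => //=; have [uY|uY] := boolP (u \in Y).
  by rewrite (subsetP YY').
by case: ifP => // _; rewrite leq_mul ?IHk ?IHs.
Qed.

Definition hangs v Y K :=
  [&& valid e (e v) K, uniq (labels K) & all (fun x => x \notin Y) (labels K)].

Lemma hangs_anti v Y Y' K : Y \subset Y' -> hangs v Y' K -> hangs v Y K.
Proof.
move=> /subsetP YY' /and3P[vK UK /allP aY]; apply/and3P; split=> //.
by apply/allP => x /aY; apply: contraNN => /YY'.
Qed.

Hypothesis e_sym : symmetric e.
Hypothesis e_irr : irreflexive e.
Hypothesis e_acyclic : forall c : seq V, 2 < size c -> ~~ ucycleb e c.

Definition del v : rel V := [rel x y | [&& e x y, x != v & y != v]].

Lemma del_sym v : symmetric (del v).
Proof. by move=> x y; rewrite /del /= e_sym [_ && (y != v)]andbC. Qed.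

Lemma del_path_notin v u q : u != v -> path (del v) u q -> v \notin u :: q.
Proof.
elim: q u => [|a q IHq] u uv /=; first by rewrite inE eq_sym.
by case/andP=> /and3P[_ _ av] /(IHq _ av) vq; rewrite in_cons negb_or eq_sym uv.
Qed.

(** A simple path from [u] to [u'] that avoids [v] would close up to a cycle through [v]. *)
Lemma acyclic_branch v u u' : e v u -> e v u' -> u != v ->
  connect (del v) u u' -> u = u'.
Proof.
move=> evu evu' uv /connectP[p pP u'E].
case: (shortenP pP) u'E => q qP Uq _ u'E.
case: (q =P [::]) => [q0|/eqP q0]; first by rewrite u'E q0.
suff C : ucycleb e (v :: u :: q).
  by have := @e_acyclic (v :: u :: q); rewrite C; case: q q0 {C u'E qP Uq} => // a q _ /(_ isT).
have vq : v \notin u :: q.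
  exact: del_path_notin uv qP.
rewrite /ucycleb; apply/andP; split; last by rewrite cons_uniq vq.
rewrite /= evu rcons_path -u'E e_sym evu' andbT.
by apply: sub_path qP => a b /and3P[].
Qed.

Lemma valid_connect z u K y : valid e (e u) K -> z \notin u :: labels K ->
  y \in u :: labels K -> connect (del z) u y.
Proof.
elim: K u => [|w k IHk s IHs] u /=.
  by move=> _ _; rewrite inE => /eqP->; apply: connect0.
case/and3P=> euw vk vs; rewrite !in_cons mem_cat !negb_or => /and4P[zu zw zk zs].
rewrite mem_cat !orbA -orbA -orbA; case/or4P=> [/eqP->|/eqP->|yk|ys].
- exact: connect0.
- by apply: connect1; rewrite /del /= euw eq_sym zu eq_sym zw.
- apply: connect_trans (connect1 _) (IHk w vk _ _); rewrite ?inE ?negb_or ?zw ?yk ?orbT //.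
  by rewrite /del /= euw eq_sym zu eq_sym zw.
- by apply: IHs; rewrite ?inE ?negb_or ?zu ?ys ?orbT.
Qed.

Lemma valid_connect_e u K y : valid e (e u) K -> y \in u :: labels K ->
  connect e u y.
Proof.
elim: K u => [|w k IHk s IHs] u /=.
  by move=> _; rewrite inE => /eqP->; apply: connect0.
case/and3P=> euw vk vs; rewrite !in_cons mem_cat.
case/or4P=> [/eqP->|/eqP->|yk|ys].
- exact: connect0.
- exact: connect1.
- by apply: connect_trans (connect1 euw) (IHk w vk _); rewrite inE yk orbT.
- by apply: IHs; rewrite ?inE ?ys ?orbT.
Qed.

(** Branches below different neighbours of [v] have disjoint labels: a common label would connect
    these neighbours off [v], against [acyclic_branch]. The branches avoid [v] because [v] is in
    [Y]. *)
Lemma hangs_mk v Y (C : {set V}) (Kf : V -> forest V) : v \in Y ->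
    {in C, forall u, [&& e v u, u \notin Y & hangs u (u |: Y) (Kf u)]} ->
  hangs v Y (mk [seq (u, Kf u) | u <- enum C]).
Proof.
move=> vY HC.
have av u : u \in C -> v \notin u :: labels (Kf u).
  move=> /HC/and3P[_ uY /and3P[_ _ /allP aY]]; apply/negP; rewrite inE.
  case/orP=> [/eqP vu|/aY]; first by rewrite -vu vY in uY.
  by rewrite !inE vY orbT.
apply/and3P; split.
- rewrite valid_mk all_map; apply/allP => u; rewrite mem_enum => /HC/and3P[evu _ /and3P[vK _ _]].
  by rewrite /= evu vK.
- rewrite labels_mk -map_comp; apply: uniq_flatten_map; first exact: enum_uniq.
    move=> u; rewrite mem_enum => /HC/and3P[_ uY /and3P[_ UK /allP aY]] /=.
    by rewrite UK andbT; apply/negP => /aY; rewrite setU11.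
  move=> u w x; rewrite !mem_enum => uC wC /= xu xw.
  have /and3P[evu _ /and3P[vu _ _]] := HC u uC.
  have /and3P[evw _ /and3P[vw _ _]] := HC w wC.
  apply: (acyclic_branch evu evw).
    by move: (av u uC); rewrite inE negb_or eq_sym => /andP[].
  apply: connect_trans (valid_connect vu (av u uC) xu) _.
  by rewrite (sym_connect_sym (del_sym v)); apply: valid_connect vw (av w wC) xw.
- rewrite labels_mk -map_comp; apply/allP => x /flatten_mapP[u]; rewrite mem_enum.
  move=> /HC/and3P[_ uY /and3P[_ _ /allP aY]] /=.
  by rewrite inE => /orP[/eqP->//|/aY]; rewrite !inE negb_or => /andP[].
Qed.

Lemma gfac_mk_enum (C : {set V}) (Kf : V -> forest V) :
  gfac (mk [seq (u, Kf u) | u <- enum C]) =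
  #|C|`! * \prod_(u in C) gfac (Kf u).
Proof.
by rewrite /gfac roots_mk fac_mk -map_comp size_map -cardE big_map big_enum.
Qed.

Lemma size_mk_enum (C : {set V}) (Kf : V -> forest V) :
  size (labels (mk [seq (u, Kf u) | u <- enum C])) =
  \sum_(u in C) (size (labels (Kf u))).+1.
Proof. by rewrite size_labels_mk big_map big_enum. Qed.

(** With [hangs], this makes [K] the full search tree below [v] off [Y]. As [v] itself belongs to
    [Y] when this is used, it has to be readmitted as an endpoint. *)
Definition spans v Y K := forall a b, a \in v :: labels K -> b \notin Y :\ v ->
  e a b -> (a, b) \in pairs v K \/ (b, a) \in pairs v K.

(** Depth-first search, by induction on the complement of [Y]. Placing [F] below [v] means choosing
    distinct children in order at each vertex met, and a vertex with d children in [K] leaves at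
    most d! choices, whatever [F] is. *)
Lemma explore v Y : v \in Y -> exists K,
  [/\ hangs v Y K, spans v Y K & forall F : forest V, cnt F v Y <= gfac K].
Proof.
have [m] := ubnP #|~: Y|; elim: m v Y => // m IHm v Y Ym vY.
set D := [set u | e v u & u \notin Y].
have /fin_all_exists[Kf HK] : forall u, exists K, u \in D ->
    [/\ hangs u (u |: Y) K, spans u (u |: Y) K
      & forall F : forest V, cnt F u (u |: Y) <= gfac K].
  move=> u.
  have [uD|_] := boolP (u \in D); last by exists Nil.
  have [|//|K HK] := IHm u (u |: Y); rewrite ?setU11 //; last by exists K.
  move: uD; rewrite inE => /andP[_ uY].
  rewrite -ltnS (leq_trans _ Ym) // ltnS; apply: proper_card.
  rewrite setCU; apply/properP; split; first exact: subsetIr.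
  by exists u; rewrite !inE ?uY // eqxx.
exists (mk [seq (u, Kf u) | u <- enum D]); split.
- apply: hangs_mk => // u uD; have [-> _ _] := HK u uD.
  by move: uD; rewrite inE => /andP[-> ->].
- move=> a b; rewrite pairs_mk -map_comp in_cons => aK bY eab.
  have dir u c : u \in D -> c \in (v, u) :: pairs u (Kf u) ->
      c \in flatten [seq ((fun p => (v, p.1) :: pairs p.1 p.2) \o
                           (fun u => (u, Kf u))) i | i <- enum D].
    by move=> uD cu; apply/flatten_mapP; exists u; rewrite ?mem_enum.
  have far u : u \in D -> (v, u) \in flatten [seq
      ((fun p => (v, p.1) :: pairs p.1 p.2) \o (fun u => (u, Kf u))) i | i <- enum D].
    by move=> uD; apply: dir uD _; rewrite mem_head.
  case/orP: aK => [/eqP av|].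
    left; rewrite av; apply: far; rewrite inE -av eab.
    move: bY; rewrite !inE negb_and negbK => /orP[/eqP bv|//].
    by rewrite av bv e_irr in eab.
  rewrite labels_mk -map_comp => /flatten_mapP[u]; rewrite mem_enum => uD /= au.
  have [/and3P[_ _ /allP aY] su _] := HK u uD.
  have [bv|bv] := eqVneq b v.
    right; rewrite bv; apply: far; rewrite inE -bv e_sym eab /=.
    move: au; rewrite inE => /orP[/eqP->|/aY]; last by rewrite !inE negb_or => /andP[].
    by move: uD; rewrite inE => /andP[].
  have bY' : b \notin (u |: Y) :\ u.
    by move: bY; rewrite !inE bv /= !negb_and !negb_or => ->; rewrite andbT orNb.
  by have [h|h] := su a b au bY' eab; [left|right]; apply: dir uD _; rewrite inE h orbT.
move=> F; rewrite gfac_mk_enum.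
(* [Y'] adds to [Y] the siblings already placed. Each further root chooses [u] among the free
   children, taking one factor off the factorial and [gfac (Kf u)] off the product. *)
suff H Y' : Y \subset Y' -> cnt F v Y' <= #|D :\: Y'|`! * \prod_(u in D :\: Y') gfac (Kf u).
  have DY : D :\: Y = D.
    by apply/setP => u; rewrite !inE; case: (u \in Y); rewrite ?andbF.
  by have := H Y (subxx Y); rewrite DY.
elim: F Y' => [|x k _ s IHs] Y' YY'.
  by rewrite cnt_nil muln_gt0 fact_gt0 prodn_gt0 // => u; apply: gfac_gt0.
have DE : [set u | e v u & u \notin Y'] = D :\: Y'.
  apply/setP => u; rewrite !inE; have [uY'|uY'] := boolP (u \in Y'); first by rewrite andbF.
  by rewrite /= (contraNN (subsetP YY' u)) ?andbT.
rewrite cnt_cons DE.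
apply: (@leq_trans (\sum_(u in D :\: Y') ((#|D :\: Y'|).-1)`! *
                    \prod_(u in D :\: Y') gfac (Kf u))).
  apply: leq_sum => u uDY; have := uDY; rewrite inE => /andP[uY' uD].
  have [_ _ Ku] := HK u uD.
  rewrite (bigD1 u uDY) /= mulnCA leq_mul //.
    by apply: leq_trans (cnt_anti _ _ (setUS _ YY')) (Ku _).
  have Yu : Y \subset u |: Y' by apply: subset_trans YY' (subsetUr _ _).
  have Du : D :\: (u |: Y') = (D :\: Y') :\ u by rewrite setDDl setUC.
  apply: leq_trans (IHs _ Yu) _; rewrite Du [#|D :\: Y'|](cardsD1 u) uDY.
  rewrite leq_mul //.
    by rewrite leq_eqVlt; apply/orP; left; apply/eqP; apply: eq_bigl => w; rewrite in_setD1 andbC.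
rewrite sum_nat_const mulnA leq_mul //.
by case: #|_| => // d; rewrite factS.
Qed.

End Embeddings.

(** * The pointwise embedding bound *)

Section Analysis.
Variable R : realType.

Lemma prodr_ge1 (I : Type) (r : seq I) (P : pred I) (F : I -> R) :
  (forall i, 1 <= F i) -> 1 <= \prod_(i <- r | P i) F i.
Proof. by move=> F1; elim/big_ind: _ => // x y; apply: mulr_ege1. Qed.

(** Near-maximisers suffice, so that no supremum over the infinite type of forests has to be
    attained. *)
Lemma near_sup (T : Type) (A : T -> Prop) (f : T -> R) (b : R) :
    (exists t, A t) -> (forall t, A t -> 0 < f t <= b) ->
  exists2 t, A t & forall t', A t' -> f t' <= 2 * f t.
Proof.
move=> [t0 At0] Ab; pose E : classical_sets.set R := fun r => exists2 t, A t & f t = r.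
have Esup : classical_sets.has_sup E.
  split; first by exists (f t0), t0.
  by exists b => _ [t /Ab/andP[_ tb] <-].
have E0 : 0 < sup E.
  apply: lt_le_trans (_ : f t0 <= _); first by have /andP[] := Ab t0 At0.
  by apply: sup_upper_bound => //; exists t0.
have [|_ [t At <-] tE] := @sup_adherent R E (sup E / 2) _ Esup.
  by rewrite divr_gt0.
exists t => // t' At'; apply: (@le_trans _ _ (sup E)).
  by apply: sup_upper_bound => //; exists t'.
by lra.
Qed.

(* At the last rank where the maximum exceeds 1, every smaller rank can be
   compared with that one, and the loss d^d / d! is at most 4^d. *)
Lemma prod_max_rank_le (Q M : R) (w : nat -> R) (d : nat) :
    0 < Q -> (forall i, 0 <= w i) ->
    (forall i j, (i <= j < d)%N -> w j <= w i) ->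
    (forall c, (c <= d)%N -> c`!%:R * \prod_(i < c) w i <= M * Q ^+ c) ->
  \prod_(i < d) Num.max 1 (i.+1%:R * w i / (4 * Q)) <= M.
Proof.
move=> Q0 w0; elim: d => [|d IHd] wd Hc.
  by have := Hc 0%N isT; rewrite !big_ord0 fact0 !mulr1.
have Q4 : 0 < 4 * Q by rewrite mulr_gt0.
have [a1|a1] := leP (d.+1%:R * w d / (4 * Q)) 1.
  rewrite big_ord_recr /= (max_idPl a1) mulr1; apply: IHd => [i j /andP[ij jd]|c cd].
    by apply: wd; rewrite ij ltnW.
  by apply: Hc; apply: leqW.
apply: (@le_trans _ _ (\prod_(i < d.+1) (d.+1%:R / (4 * Q) * w i))).
  apply: ler_prod => i _; rewrite le_max ler01 /= ge_max mulrAC.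
  apply/andP; split.
    apply: le_trans (ltW a1) _; rewrite ler_pM2r ?invr_gt0 //.
    by rewrite ler_pM2l ?ltr0n // wd // -ltnS ltn_ord ltnSn.
  by rewrite ler_pM2r ?invr_gt0 // ler_wpM2r // ler_nat.
rewrite big_split /= prodr_const card_ord expr_div_n mulrAC ler_pdivrMr ?exprn_gt0 //.
rewrite exprMn mulrCA; apply: (@le_trans _ _ ((d.+1`! * 4 ^ d.+1)%:R * \prod_(i < d.+1) w i)).
  apply: ler_wpM2r; first by apply: prodr_ge0 => i _.
  by rewrite -natrX ler_nat expn_le_fact_mul4.
rewrite natrM natrX mulrAC mulrC ler_pM2l ?exprn_gt0 //.
exact: Hc.
Qed.

(** If [d <= 16 * Q], then already [d ^ r] is small enough. Otherwise the excess
    [(d / (16 * Q)) ^ r] grows with [r], and at [r = d] it is [(d / (4 * Q)) ^ d / 4 ^ d], hence at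
    most y / 4^d; the power of 4 beats the square of the logarithm since [ln y <= d * d]. *)
Lemma ffact_le_damp (Q : R) (d r : nat) : 1 <= Q -> 4 * Q <= d%:R -> (r <= d)%N ->
  (d ^_ r)%:R <= (16 * Q) ^+ r * damp (d`!%:R / Q ^+ d).
Proof.
move=> Q1 Qd rd; set y := _ / _.
have Q0 : 0 < Q by lra.
have Qd0 : 0 < Q ^+ d by rewrite exprn_gt0.
have d1 : (1 <= d)%N by rewrite -(ltr_nat R); lra.
have yl : (d%:R / (4 * Q)) ^+ d <= y.
  rewrite expr_div_n exprMn invfM mulrA ler_pM2r ?invr_gt0 //.
  rewrite ler_pdivrMr ?exprn_gt0 // -!natrX -natrM ler_nat.
  exact: expn_le_fact_mul4.
have y1 : 1 <= y.
  apply: le_trans yl; rewrite exprn_ege1 // ler_pdivlMr ?mul1r //; lra.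
have a0 : 0 <= d%:R / (16 * Q) by rewrite divr_ge0 ?ler0n //; lra.
have -> : (d ^_ r)%:R = (16 * Q) ^+ r * ((d ^_ r)%:R / (16 * Q) ^+ r).
  by rewrite mulrC divfK // expf_neq0 // gt_eqF //; lra.
rewrite ler_pM2l ?exprn_gt0 //; last lra.
apply: (@le_trans _ _ ((d%:R / (16 * Q)) ^+ r)).
  rewrite expr_div_n ler_pM2r ?invr_gt0 ?exprn_gt0 //; last lra.
  by rewrite -natrX ler_nat ffact_leq_expn.
have [a1|a1] := leP (d%:R / (16 * Q)) 1.
  by apply: le_trans (exprn_ile1 _ a0 a1) (damp_ge1 y1).
apply: (@le_trans _ _ ((d%:R / (16 * Q)) ^+ d)); first by rewrite ler_weXn2l // ltW.
have -> : d%:R / (16 * Q) = (d%:R / (4 * Q)) / 4.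
  by field; rewrite gt_eqF.
rewrite [leLHS]expr_div_n /damp ler_pM ?invr_ge0 ?exprn_ge0 //.
  by rewrite divr_ge0 ?ler0n //; lra.
rewrite lef_pV2 ?posrE ?exprn_gt0 ?damp_den_gt0 //.
have -> : 4 ^+ d = (2 ^+ d) ^+ 2 :> R by rewrite exprAC; congr (_ ^+ _); ring.
rewrite lerXn2r ?nnegrE ?exprn_ge0 ?(ltW (damp_den_gt0 y1)) //.
have dd : ln y <= d%:R * d%:R.
  apply: (@le_trans _ _ (ln (d%:R ^+ d))).
    rewrite ler_ln ?posrE ?exprn_gt0 ?ltr0n //; last lra.
    rewrite ler_pdivrMr // -[leLHS]mulr1 ler_pM ?ler0n ?exprn_ege1 //.
    by rewrite -natrX ler_nat -ffactnn ffact_leq_expn.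
  rewrite lnXn ?ltr0n // mulr_natl lerMn2r; apply/orP; right.
  by rewrite ltW // ln_sublinear ?ltr0n.
have : (2 + d * d <= 2 ^ d.+1)%N.
  by elim: {d1 Qd Qd0 rd y y1 yl a0 a1 dd} d => // d IHd; rewrite expnS; nia.
rewrite -(ler_nat R) natrD natrM natrX exprS; lra.
Qed.

(** * Summing damped weights over ranked children *)

Section SumDamp.
Variable V : finType.
Implicit Types (S : {set V}) (s : seq V) (Z : V -> R).

Lemma sum_index_le S s (f : nat -> R) : uniq s -> {subset S <= s} ->
  (forall i, 0 <= f i) ->
  \sum_(u in S) f (index u s) <= \sum_(i < size s) f i.
Proof.
move=> Us Ss f0.
have -> : \sum_(i < size s) f i = \sum_(u in s) f (index u s).
  rewrite -big_uniq //; case: s Us {Ss} => [|x0 s] Us; first by rewrite big_ord0 big_nil.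
  rewrite (big_nth x0) big_mkord; apply: eq_bigr => i _.
  by rewrite index_uniq.
rewrite [leLHS]big_mkcond [leRHS]big_mkcond /=; apply: ler_sum => u _.
by case: ifP => [/Ss ->//|_]; case: ifP.
Qed.

(* At most one [u] has [ln (Z u) > ln m / 2]; for all others the second factor
   already yields [damp m], and the first one is summable over the ranks. *)
Lemma sum_damp_le S s Z (X m : R) : uniq s -> {subset S <= s} ->
    (size s)%:R <= X -> 0 < X -> (forall u, 1 <= Z u) -> \prod_(u in S) Z u <= m ->
  \sum_(u in S) damp (X / (index u s).+1%:R * Z u) * damp (m / Z u) <=
    20 * X * damp m.
Proof.
move=> Us Ss sX X0 Z1 Zm.
have Z0 u : 0 < Z u by apply: lt_le_trans (Z1 u).
have m1 : 1 <= m by apply: le_trans Zm; apply: prodr_ge1.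
have m0 : 0 < m by lra.
have zm u : u \in S -> ln (Z u) <= ln m.
  move=> uS; rewrite ler_ln ?posrE //; apply: le_trans Zm; rewrite (bigD1 u) //=.
  by rewrite ler_peMr ?prodr_ge1 // ltW.
have zz u w : u \in S -> w \in S -> u != w -> ln (Z u) + ln (Z w) <= ln m.
  move=> uS wS uw; rewrite -lnM ?posrE // ler_ln ?posrE ?mulr_gt0 //.
  apply: le_trans Zm; rewrite (bigD1 u) //= ler_pM2l // (bigD1 w) /=; last by rewrite wS eq_sym.
  by rewrite ler_peMr ?prodr_ge1 // ltW.
pose g (i : nat) : R := (i.+1%:R)^-1 * (1 + ln (X / i.+1%:R) / 2)^-1 ^+ 2.
have dm0 : 0 < damp m by apply: damp_gt0.
have X1 u : u \in S -> 1 <= X / (index u s).+1%:R.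
  move=> uS; rewrite ler_pdivlMr ?ltr0n // mul1r; apply: le_trans sX.
  by rewrite ler_nat index_mem Ss.
have termE u : u \in S ->
    damp (X / (index u s).+1%:R * Z u) * damp (m / Z u) =
    X * (index u s).+1%:R^-1 * m /
    ((1 + (ln (X / (index u s).+1%:R) + ln (Z u)) / 2) *
     (1 + (ln m - ln (Z u)) / 2)) ^+ 2.
  move=> uS; have i0 : 0 < (index u s).+1%:R :> R by rewrite ltr0n.
  rewrite /damp lnM ?posrE ?divr_gt0 // [ln (m / _)]ln_div ?posrE // mulrACA -invfM exprMn.
  congr (_ / _); rewrite -!mulrA; congr (_ * (_ * _)).
  by rewrite mulrCA mulfV ?mulr1 // gt_eqF.
have dmE c : c * damp m = c * m / (1 + ln m / 2) ^+ 2 by rewrite mulrA.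
(* For the exceptional [u] the first denominator contains [ln (Z u) / 2], more than a quarter of
   [ln m], which gives the saving up to a factor 4. *)
have bound_hi : forall u, u \in S -> ln m / 2 < ln (Z u) ->
    damp (X / (index u s).+1%:R * Z u) * damp (m / Z u) <= 4 * X * damp m.
  move=> u uS big; rewrite termE // dmE.
  have a0 := ln_ge0 (X1 u uS); have z0 := ln_ge0 (Z1 u); have mz := zm u uS.
  have M0 := ln_ge0 m1; set a := ln (X / _) in a0 *; set z := ln (Z u) in big z0 mz *.
  set M := ln m in M0 mz big *.
  rewrite ler_pdivrMr; last by rewrite exprn_gt0 // mulr_gt0; lra.
  rewrite [leRHS]mulrAC ler_pdivlMr; last by rewrite exprn_gt0 //; lra.
  have -> : 4 * X * m * ((1 + (a + z) / 2) * (1 + (M - z) / 2)) ^+ 2 =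
            X * m * (2 * ((1 + (a + z) / 2) * (1 + (M - z) / 2))) ^+ 2 by ring.
  apply: ler_pM; rewrite ?mulr_ge0 ?exprn_ge0 ?invr_ge0 ?ler0n //; try lra.
    rewrite [leLHS]mulrAC; apply: ler_piMr; first by rewrite mulr_ge0 // ltW.
    by rewrite invf_le1 ?ltr0n // ler1n.
  by rewrite lerXn2r ?nnegrE; nra.
have bound_lo : forall u, u \in S -> ln (Z u) <= ln m / 2 ->
    damp (X / (index u s).+1%:R * Z u) * damp (m / Z u) <=
    4 * X * damp m * g (index u s).
  move=> u uS small; rewrite termE // /g /damp.
  have a0 := ln_ge0 (X1 u uS); have z0 := ln_ge0 (Z1 u).
  have M0 := ln_ge0 m1; set a := ln (X / _) in a0 *; set z := ln (Z u) in small z0 *.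
  set M := ln m in M0 small *; set i := _%:R^-1.
  have i0 : 0 <= i by rewrite invr_ge0 ler0n.
  rewrite exprVn.
  have -> : 4 * X * (m / (1 + M / 2) ^+ 2) * (i / (1 + a / 2) ^+ 2) =
     X * i * m / ((1 + a / 2) * (2^-1 * (1 + M / 2))) ^+ 2.
    by field; apply/andP; split; apply: lt0r_neq0; lra.
  apply: ler_wpM2l; first by rewrite !mulr_ge0 // ltW.
  rewrite lef_pV2 ?posrE ?exprn_gt0 ?mulr_gt0 //; try lra.
  rewrite lerXn2r ?nnegrE ?mulr_ge0 //; try lra.
  by apply: ler_pM; lra.
have Xd : 0 < 4 * X * damp m by apply: mulr_gt0 => //; apply: mulr_gt0.
have g_sum (T : {set V}) : T \subset S ->
    \sum_(u in T) 4 * X * damp m * g (index u s) <= 16 * X * damp m.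
  move=> TS; rewrite -mulr_sumr.
  have -> : 16 * X * damp m = 4 * X * damp m * 4 by ring.
  rewrite ler_pM2l //; apply: le_trans _ (sum_inv_damp_le4 sX).
  apply: sum_index_le => //; first by move=> u /(subsetP TS)/Ss.
  by move=> i; rewrite mulr_ge0 ?invr_ge0 ?ler0n // exprn_even_ge0.
(* The constant 20 is 4 for the exceptional term plus 4 * 4 for the sum over ranks. *)
case: (boolP [exists u in S, ln m / 2 < ln (Z u)]) => [/exists_inP[u uS big]|small].
  rewrite (bigD1 u) //=.
  have -> : 20 * X * damp m = 4 * X * damp m + 16 * X * damp m by ring.
  apply: lerD; first exact: bound_hi.
  apply: le_trans _ (g_sum (S :\ u) (subsetDl _ _)).
  rewrite [leRHS](eq_bigl (fun w => (w \in S) && (w != u))); last first.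
    by move=> w; rewrite in_setD1 andbC.
  apply: ler_sum => w /andP[wS wu]; apply: bound_lo => //.
  by have := zz w u wS uS wu; lra.
apply: le_trans (_ : 16 * X * damp m <= _); last by lra.
apply: le_trans _ (g_sum S (subxx S)); apply: ler_sum => u uS; apply: bound_lo => //.
by move: small; rewrite negb_exists_in => /forall_inP/(_ u uS); rewrite -leNgt.
Qed.

End SumDamp.
End Analysis.

(** * Induction on the embedded tree *)

Section Pointwise.
Variables (R : realType) (V : finType) (e : rel V).
Hypothesis e_sym : symmetric e.
Hypothesis e_acyclic : forall c : seq V, (2 < size c)%N -> ~~ ucycleb e c.
Variable P : R.
Implicit Types (v u : V) (Y : {set V}) (F K k s : forest V) (M : R).

(** [M] bounds the weights of all subtrees rooted at [v] with their other vertices off [Y]; [P] will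
    be [4 * p]. *)
Definition wbound v Y M := forall K, hangs e v Y K ->
  (gfac K)%:R <= M * P ^+ size (labels K).

Lemma wbound_anti v Y Y' M : Y \subset Y' -> wbound v Y M -> wbound v Y' M.
Proof. by move=> YY' wY K /(hangs_anti YY')/wY. Qed.

(** [W u] is twice the weight of a nearly heaviest subtree at [u]. The chosen subtrees at the
    vertices of [C] hang together below [v], so the bound at [v] applies to their union; the factors
    2 turn [P] into [2 * P]. *)
Lemma child_weights v Y M : 0 < P -> v \in Y -> wbound v Y M ->
  let D := [set u | e v u & u \notin Y] in
  exists W : V -> R, [/\ forall u, 1 <= W u,
    {in D, forall u, wbound u (u |: Y) (W u)} &
    forall C : {set V}, C \subset D ->
      (#|C|)`!%:R * \prod_(u in C) W u <= M * (2 * P) ^+ #|C|].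
Proof.
move=> P0 vY wM D.
have P_gt0 m : 0 < P ^+ m by rewrite exprn_gt0.
pose f K : R := (gfac K)%:R / P ^+ size (labels K).
have /fin_all_exists[Kf HK] : forall u, exists K, u \in D ->
    hangs e u (u |: Y) K /\ forall K', hangs e u (u |: Y) K' -> f K' <= 2 * f K.
  move=> u; have [uD|_] := boolP (u \in D); last by exists Nil.
  have := uD; rewrite inE => /andP[evu uY].
  (* The bound [M * P] comes from hanging the single branch at [u] below [v], which adds one
     edge. *)
  case: (@near_sup R _ (fun K => hangs e u (u |: Y) K) f (M * P)).
  - by exists Nil.
  - move=> K HK; rewrite divr_gt0 ?ltr0n ?gfac_gt0 //= ler_pdivrMr //.
    have H1 : {in [set u], forall w, [&& e v w, w \notin Y & hangs e w (w |: Y) K]}.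
      by move=> w; rewrite inE => /eqP->; rewrite evu uY.
    have := wM _ (hangs_mk e_sym e_acyclic (Kf := fun=> K) vY H1).
    rewrite gfac_mk_enum size_mk_enum cards1 !big_set1 mul1n exprS.
    by rewrite mulrA.
  - by move=> K HK HK'; exists K.
exists (fun u => if u \in D then 2 * f (Kf u) else 1); split.
- move=> u; case: ifP => // uD; have [_ /(_ Nil isT)] := HK u uD.
  by rewrite {1}/f divr1.
- move=> u uD K hK; rewrite uD; have [_ /(_ K hK)] := HK u uD.
  by rewrite {1}/f ler_pdivrMr.
- move=> C CD.
  have HC : {in C, forall u, [&& e v u, u \notin Y & hangs e u (u |: Y) (Kf u)]}.
    move=> u /(subsetP CD) uD; have [-> _] := HK u uD.
    by move: uD; rewrite inE => /andP[-> ->].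
  have := wM _ (hangs_mk e_sym e_acyclic vY HC).
  rewrite gfac_mk_enum size_mk_enum natrM natr_prod => H.
  rewrite [X in _ * X](eq_bigr (fun u => 2 * P * ((gfac (Kf u))%:R / P ^+ (size (labels (Kf u))).+1))); last first.
    move=> u uC; rewrite (subsetP CD) // /f exprS.
    by field; rewrite !gt_eqF.
  rewrite big_split /= prodr_const big_split /= prodfV prodrXr.
  rewrite !mulrA ler_pdivrMr // [leRHS]mulrAC [leLHS]mulrAC ler_pM2r //.
  by rewrite exprn_gt0 // mulr_gt0.
Qed.

Fixpoint subs F : seq (forest V) := if F is Cons _ k s then k :: subs s else [::].

Hypothesis P1 : 1 <= P.

(* The constant 160 = 20 * 8 comes from [sum_damp_le] with [X = 8 * P]. *)
Definition bounded F := forall v Y M, v \in Y -> 1 <= M -> wbound v Y M ->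
  (cnt e F v Y)%:R <= (160 * P) ^+ size (labels F) * damp M.

(** Used when [v] has more than [8 * P] children. By supermultiplicativity every choice of [u]
    contributes at most [damp] of the product of all free weights, and the choices of the roots form
    the falling factorial. *)
Lemma cnt_many_children F v Y (W : V -> R) :
    {in subs F, forall k, bounded k} -> (forall u, 1 <= W u) ->
    let D := [set u | e v u & u \notin Y] in
    {in D, forall u, wbound u (u |: Y) (W u)} ->
  forall Y', Y \subset Y' ->
  (cnt e F v Y')%:R <= (160 * P) ^+ size (tpairs F) *
    (#|D :\: Y'| ^_ size (roots F))%:R * damp (\prod_(u in D :\: Y') W u).
Proof.
move=> bF W1 D WD; have le1P : 1 <= P := P1; have P0 : 0 < P := lt_le_trans ltr01 P1.
have PP m : 0 <= (160 * P) ^+ m by rewrite exprn_ge0 // mulr_ge0 // ltW.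
elim: F bF => [|x k _ s IHs] bF Y' YY'.
  by rewrite cnt_nil expr0 ffactn0 !mul1r damp_ge1 // prodr_ge1.
have DE : [set u | e v u & u \notin Y'] = D :\: Y'.
  apply/setP => u; rewrite !inE; have [uY'|uY'] := boolP (u \in Y'); first by rewrite andbF.
  by rewrite /= (contraNN (subsetP YY' u)) ?andbT.
rewrite cnt_cons DE natr_sum.
set d := #|D :\: Y'|; set Pi := \prod_(u in _) _.
have Pi1 : 1 <= Pi by apply: prodr_ge1.
pose c := (160 * P) ^+ size (tpairs (Cons x k s)) * (d.-1 ^_ size (roots s))%:R * damp Pi.
apply: (@le_trans _ _ (\sum_(u in D :\: Y') c)); last first.
  rewrite sumr_const -/d -[leLHS]mulr_natr le_eqVlt; apply/orP; left; apply/eqP.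
  by rewrite /c /= ffactnS natrM; ring.
apply: ler_sum => u uDY; have := uDY; rewrite inE => /andP[uY' uD].
have Yu : Y \subset u |: Y' by apply: subset_trans YY' (subsetUr _ _).
have Ik : (cnt e k u (u |: Y'))%:R <= (160 * P) ^+ size (labels k) * damp (W u).
  apply: bF; rewrite ?mem_head ?setU11 //.
  by apply: wbound_anti (WD u uD); apply: setUS.
have Is : (cnt e s v (u |: Y'))%:R <= (160 * P) ^+ size (tpairs s) *
    (d.-1 ^_ size (roots s))%:R * damp (\prod_(w in D :\: Y' :\ u) W w).
  have Du : D :\: (u |: Y') = (D :\: Y') :\ u by rewrite setDDl setUC.
  have -> : d.-1 = #|D :\: Y' :\ u| by rewrite /d (cardsD1 u) uDY.
  by rewrite -Du; apply: IHs => // k' k's; apply: bF; rewrite inE k's orbT.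
rewrite natrM.
apply: le_trans (ler_pM (ler0n _ _) (ler0n _ _) Ik Is) _.
rewrite /c /= size_cat size_pairs exprD.
set A := _ ^+ size (labels k); set B := _ ^+ size (tpairs s).
rewrite [leLHS](_ : _ = A * B * (d.-1 ^_ size (roots s))%:R *
   (damp (W u) * damp (\prod_(w in D :\: Y' :\ u) W w))); last by ring.
apply: ler_wpM2l; first by rewrite !mulr_ge0 ?PP.
apply: le_trans (damp_super (W1 u) (prodr_ge1 _ _ W1)) _.
rewrite /Pi (bigD1 u uDY) /= le_eqVlt; apply/orP; left; apply/eqP.
by congr (damp (_ * _)); apply: eq_bigl => w; rewrite in_setD1 andbC.
Qed.

(** Used for at most [8 * P] children. [Z u] is the excess of [W u] over [8 * P / rank], and [m] is
    the budget for the excesses of the free children; each root of [F] takes one application of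
    [sum_damp_le]. *)
Lemma cnt_few_children F v Y (W Z : V -> R) (r : seq V) :
    {in subs F, forall k, bounded k} -> (forall u, 1 <= W u) -> (forall u, 1 <= Z u) ->
    let D := [set u | e v u & u \notin Y] in
    {in D, forall u, wbound u (u |: Y) (W u)} ->
    uniq r -> r =i D -> (size r)%:R <= 8 * P ->
    {in D, forall u, W u <= 8 * P / (index u r).+1%:R * Z u} ->
  forall Y' m, Y \subset Y' -> \prod_(u in D :\: Y') Z u <= m ->
  (cnt e F v Y')%:R <= (160 * P) ^+ size (labels F) * damp m.
Proof.
move=> bF W1 Z1 D WD Ur rD r8 WZ; have le1P : 1 <= P := P1; have P0 : 0 < P := lt_le_trans ltr01 P1.
have PP m : 0 <= (160 * P) ^+ m by rewrite exprn_ge0 // mulr_ge0 // ltW.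
elim: F bF => [|x k _ s IHs] bF Y' m YY' Zm.
  by rewrite cnt_nil expr0 mul1r damp_ge1 //; apply: le_trans Zm; apply: prodr_ge1.
have DE : [set u | e v u & u \notin Y'] = D :\: Y'.
  apply/setP => u; rewrite !inE; have [uY'|uY'] := boolP (u \in Y'); first by rewrite andbF.
  by rewrite /= (contraNN (subsetP YY' u)) ?andbT.
rewrite cnt_cons DE natr_sum /= size_cat exprS exprD.
set A := _ ^+ size (labels k); set B := _ ^+ size (labels s).
apply: (@le_trans _ _ (\sum_(u in D :\: Y')
    A * B * (damp (8 * P / (index u r).+1%:R * Z u) * damp (m / Z u)))); last first.
  rewrite -mulr_sumr [leRHS](_ : _ = A * B * (20 * (8 * P) * damp m)); last by ring.
  apply: ler_wpM2l; first exact: mulr_ge0 (PP _) (PP _).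
  apply: sum_damp_le => //; last by rewrite mulr_gt0.
  by move=> u; rewrite inE rD => /andP[].
apply: ler_sum => u uDY; have := uDY; rewrite inE => /andP[uY' uD].
have Yu : Y \subset u |: Y' by apply: subset_trans YY' (subsetUr _ _).
have Z0 : 0 < Z u by apply: lt_le_trans (Z1 u).
have Ik : (cnt e k u (u |: Y'))%:R <= A * damp (8 * P / (index u r).+1%:R * Z u).
  apply: (@le_trans _ _ (A * damp (W u))).
    apply: bF; rewrite ?mem_head ?setU11 //.
    by apply: wbound_anti (WD u uD); apply: setUS.
  by rewrite ler_wpM2l ?PP // damp_le // WZ.
have Is : (cnt e s v (u |: Y'))%:R <= B * damp (m / Z u).
  apply: IHs => //; first by move=> k' k's; apply: bF; rewrite inE k's orbT.
  rewrite ler_pdivlMr // mulrC; apply: le_trans Zm.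
  rewrite [leRHS](bigD1 u uDY) /= ler_pM2l // le_eqVlt; apply/orP; left; apply/eqP.
  apply: eq_bigl => w; rewrite -[RHS]/((w \in D :\: Y') && (w != u)) !in_setD in_setU1.
  by rewrite negb_or [RHS]andbC andbA.
by rewrite natrM mulrACA ler_pM ?ler0n.
Qed.

Lemma bounded_of_subs F : {in subs F, forall k, bounded k} -> bounded F.
Proof.
move=> bF v Y M vY M1 wM; have le1P : 1 <= P := P1; have P0 : 0 < P := lt_le_trans ltr01 P1.
have [W [W1 WD WC]] := child_weights P0 vY wM.
set D := [set u | e v u & u \notin Y] in WD WC.
have DY : D :\: Y = D.
  by apply/setP => u; rewrite !inE; case: (u \in Y); rewrite ?andbF.
(* With [Q = 2 * P] from [child_weights], [8 * P] is the [4 * Q] of both [ffact_le_damp] and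
   [prod_max_rank_le]. *)
have [D8|D8] := ltP (8 * P) (#|D|%:R).
  have H := cnt_many_children bF W1 WD (subxx Y).
  rewrite -/D DY in H; apply: le_trans H _.
  have PP m : 0 <= (160 * P) ^+ m by rewrite exprn_ge0 // mulr_ge0 // ltW.
  rewrite -size_tpairs exprD -!mulrA; apply: ler_wpM2l => //.
  have [rd|rd] := ltnP #|D| (size (roots F)).
    by rewrite ffact_small // mul0r mulr_ge0 //; apply/ltW/damp_gt0.
  set Pi := \prod_(u in D) W u; have Pi1 : 1 <= Pi by apply: prodr_ge1.
  have Q1 : 1 <= 2 * P by lra.
  have QD : 4 * (2 * P) <= #|D|%:R by lra.
  set y : R := (#|D|)`!%:R / (2 * P) ^+ #|D|.
  have QD0 : 0 < (2 * P) ^+ #|D| by rewrite exprn_gt0 //; lra.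
  have y1 : 1 <= y.
    rewrite ler_pdivlMr // mul1r.
    have := expn_le_fact_mul4 (leqnn #|D|); rewrite -(ler_nat R) natrM !natrX.
    rewrite -ler_pdivrMr ?exprn_gt0 // -expr_div_n; apply: le_trans.
    rewrite lerXn2r ?nnegrE ?divr_ge0 ?ler0n //; lra.
  have yPi : y * Pi <= M by rewrite mulrAC ler_pdivrMr // WC.
  apply: (@le_trans _ _ ((160 * P) ^+ size (roots F) * damp y * damp Pi)).
    rewrite ler_pM2r ?damp_gt0 //; apply: le_trans (ffact_le_damp Q1 QD rd) _.
    rewrite ler_pM2r ?damp_gt0 // lerXn2r ?nnegrE; lra.
  rewrite -mulrA; apply: ler_wpM2l => //.
  apply: le_trans (damp_super y1 Pi1) _; apply: damp_le => //.
  exact: mulr_ege1.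
(* Children by decreasing weight; ranks start at 1, hence the successor of [index]. *)
pose r := sort (fun a b => W b <= W a) (enum D).
have rD : r =i D by move=> u; rewrite mem_sort mem_enum.
have Ur : uniq r by rewrite sort_uniq enum_uniq.
have sr : size r = #|D| by rewrite size_sort -cardE.
pose Z u := Num.max 1 ((index u r).+1%:R * W u / (8 * P)).
have Z1 u : 1 <= Z u by rewrite le_max lexx.
have P8 : 0 < 8 * P by lra.
apply: (@cnt_few_children F v Y W Z r bF W1 Z1 WD Ur rD _ _ Y M (subxx Y)).
- by rewrite sr.
- move=> u uD; have : (index u r).+1%:R * W u / (8 * P) <= Z u.
    by rewrite le_max lexx orbT.
  by rewrite ler_pdivrMr // mulrAC ler_pdivlMr ?ltr0n // mulrC [leRHS]mulrC.
rewrite -/D DY.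
have W_nth0 i : 0 <= nth 1 (map W r) i.
  have [ir|ir] := ltnP i (size (map W r)); last by rewrite nth_default.
  have /mapP[u _ ->] := mem_nth 1 ir; exact: le_trans (W1 u).
have -> : \prod_(u in D) Z u =
    \prod_(i < size r) Num.max 1 (i.+1%:R * nth 1 (map W r) i / (4 * (2 * P))).
  rewrite -(eq_bigl _ _ rD) -big_uniq //=.
  case E : r => [|x0 r']; first by rewrite big_ord0 big_nil.
  rewrite -E (big_nth x0) big_mkord; apply: eq_bigr => i _.
  rewrite (nth_map x0) // /Z index_uniq //.
  by congr (Num.max _ (_ / _)); ring.
apply: prod_max_rank_le => //; first lra.
  move=> i j /andP[ij jr].
  case E : r => [|x0 r']; first by rewrite E in jr.
  rewrite -E !(nth_map x0) //; last exact: leq_ltn_trans jr.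
  have tr : transitive (fun a b => W b <= W a).
    by move=> b a c ab bc; apply: le_trans bc ab.
  have re : reflexive (fun a b => W b <= W a) by move=> a; apply: lexx.
  have to : total (fun a b => W b <= W a) by move=> a b; apply: le_total.
  apply: (sorted_leq_nth tr re x0 (sort_sorted to _)) => //; exact: leq_ltn_trans jr.
move=> c cr.
(* Taking the [c] heaviest children turns the bound of [child_weights] into the one on prefix
   products. *)
pose C := [set u in take c r].
have cC : #|C| = c.
  by rewrite cardsE (card_uniqP (take_uniq c Ur)) size_takel.
have CD : C \subset D by apply/subsetP => u; rewrite inE => /mem_take; rewrite rD.
have := WC C CD; rewrite cC; congr (_ * _ <= _).
rewrite (eq_bigl (mem (take c r))); last by move=> u; rewrite inE.
rewrite -big_uniq ?take_uniq //=.
case E : r => [|x0 r']; first by move: cr; rewrite E leqn0 => /eqP->; rewrite big_ord0 big_nil.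
rewrite -E (big_nth x0) big_mkord size_takel //; apply: eq_bigr => i _.
by rewrite nth_take // (nth_map x0) // (leq_trans _ cr).
Qed.

Theorem pointwise_bound F : bounded F.
Proof.
apply: bounded_of_subs; elim: F => // x k IHk s IHs k'; rewrite inE.
by case/orP=> [/eqP->|/IHs//]; apply: bounded_of_subs.
Qed.

End Pointwise.

(** * Counting the copies of a forest *)

Section Coding.
Variable V : finType.
Implicit Types (F : forest V) (cs : seq {set V}) (stk : seq V).
Local Open Scope nat_scope.

(* Depth-first decoding: the next code word is the child set of the top of the
   stack, so a labelled forest is determined by the child sets in order. *)
Fixpoint decode stk cs : seq (V * V) :=
  match stk, cs with
  | u :: stk', X :: cs' => [seq (u, w) | w <- enum X] ++ decode (enum X ++ stk') cs'
  | _, _ => [::]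
  end.

Lemma perm_pairs (v : V) F :
  perm_eq (pairs v F) ([seq (v, w) | w <- roots F] ++ tpairs F).
Proof.
elim: F => //= u k _ s IHs; rewrite perm_cons.
by rewrite perm_sym perm_catCA perm_cat2l perm_sym.
Qed.

(** Induction on the number of labels: deleting the first root and promoting its children, in the
    order of [enum], yields a forest whose roots are the stack after one decoding step. *)
Lemma code_exists F : uniq (labels F) -> exists cs,
  [/\ size cs = size (labels F), perm_eq (decode (roots F) cs) (tpairs F),
      \prod_(S <- cs) (#|S|)`! = fac F & \sum_(S <- cs) #|S| = size (tpairs F)].
Proof.
have [m] := ubnP (size (labels F)); elim: m F => // m IHm [|u k s] Fm UF.
  by exists [::]; rewrite !big_nil.
have Uk : uniq (labels k).
  by move: UF => /= /andP[_]; rewrite cat_uniq => /and3P[].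
pose S := [set x in roots k].
have pS : perm_eq (map fst (unmk k)) (enum S).
  rewrite -roots_mk unmkK; apply: uniq_perm; last by move=> x; rewrite mem_enum inE.
    apply: subseq_uniq Uk; elim: {UF Fm S} k => //= w k1 _ s1 IH.
    by rewrite eqxx; apply: subseq_trans IH (suffix_subseq _ _).
  exact: enum_uniq.
have [l pl El] := mk_perm pS.
pose F' := mk (l ++ unmk s).
have pk (T : eqType) (g : V * forest V -> seq T) :
    perm_eq (flatten (map g (l ++ unmk s))) (flatten (map g (unmk k)) ++ flatten (map g (unmk s))).
  by rewrite map_cat flatten_cat perm_cat2r perm_flatten // perm_map // perm_sym.
have pF' : perm_eq (labels F') (labels k ++ labels s).
  by rewrite labels_mk; apply: perm_trans (pk _ _) _; rewrite -!labels_mk !unmkK.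
have tF' : perm_eq (tpairs F') (tpairs k ++ tpairs s).
  by rewrite tpairs_mk; apply: perm_trans (pk _ _) _; rewrite -!tpairs_mk !unmkK.
have fF' : fac F' = fac k * fac s.
  by rewrite fac_mk big_cat -(perm_big _ pl) -!fac_mk !unmkK.
have rF' : roots F' = enum S ++ roots s.
  by rewrite roots_mk map_cat El -roots_mk unmkK.
have sS : #|S| = size (roots k).
  by rewrite cardE -(perm_size pS) -roots_mk unmkK.
have UF' : uniq (labels F') by rewrite (perm_uniq pF'); case/andP: UF.
have [|cs [h1 h2 h3 h4]] := IHm F' _ UF'.
  by rewrite (perm_size pF') -ltnS (leq_trans _ Fm).
exists (S :: cs); split.
- by rewrite /= h1 (perm_size pF').
- rewrite /= -rF'; apply: perm_trans (perm_cat (perm_refl _) h2) _.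
  apply: perm_trans (perm_cat (perm_refl _) tF') _.
  rewrite catA perm_cat2r; apply: perm_trans (_ : perm_eq _ _) _; last first.
    by rewrite perm_sym; apply: perm_pairs.
  by rewrite perm_cat2r perm_map // perm_sym -[roots k](congr1 (@roots V) (unmkK k)) roots_mk.
- by rewrite big_cons h3 fF' sS mulnA.
- rewrite big_cons h4 sS (perm_size tF') !size_cat addnA; congr (_ + _).
  by rewrite size_pairs addnC size_tpairs.
Qed.

End Coding.

(** * Kraft's inequality for codes *)

Section CodeCount.
Variable V : finType.

(** The sets of size k contribute a falling factorial times x^k, at most [(#|V| * x) ^ k]; this
    leaves a geometric series of ratio 1/2. *)
Lemma sum_fact_sets_le2 (R : realFieldType) (x : R) : 0 <= x -> #|V|%:R * x <= 2^-1 ->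
  \sum_(S : {set V}) (#|S|)`!%:R * x ^+ #|S| <= 2.
Proof.
move=> x0 xV.
rewrite (partition_big (fun S : {set V} => inord #|S| : 'I_(#|V|).+1) predT) //=.
apply: (@le_trans _ _ (\sum_(k < (#|V|).+1) 2^-1 ^+ k)).
  apply: ler_sum => k _.
  have kE (S : {set V}) : (inord #|S| == k) = (#|S| == k).
    by rewrite -val_eqE /= inordK // ltnS max_card.
  rewrite (eq_bigr (fun=> k`!%:R * x ^+ k)); last by move=> S; rewrite kE => /eqP->.
  rewrite (eq_bigl (fun S => S \in [set S : {set V} | #|S| == k])); last by move=> S; rewrite inE kE.
  rewrite sumr_const card_draws -mulrnAl -mulrnA mulnC bin_ffact.
  apply: (@le_trans _ _ ((#|V|%:R * x) ^+ k)); last by rewrite lerXn2r ?nnegrE ?mulr_ge0 ?invr_ge0 ?ler0n.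
  by rewrite exprMn ler_wpM2r ?exprn_ge0 // -natrX ler_nat ffact_leq_expn.
suff -> : \sum_(k < (#|V|).+1) 2^-1 ^+ k = 2 - 2^-1 ^+ #|V| :> R.
  by rewrite gerBl exprn_ge0 // invr_ge0.
elim: #|V| => [|m IHm]; first by rewrite big_ord1 !expr0; lra.
rewrite big_ord_recr /= IHm exprS; set y := _ ^+ m; lra.
Qed.

(* Kraft's inequality: each [f] counted has weight [p / (2 #|V|) ^ t] in the
   expansion of a [v]-th power that is at most [2 ^ v]. *)
Lemma card_codes_le (v t p : nat) : (0 < #|V|)%N ->
  (#|[set f : {ffun 'I_v -> {set V}} | (\prod_i (#|f i|)`! == p) &&
       (\sum_i #|f i| == t)]| * p <= 2 ^ v * (2 * #|V|) ^ t)%N.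
Proof.
move=> V0; set A := [set f | _]; set x : rat := (2 * #|V|%:R)^-1.
have nV0 : 0 < #|V|%:R :> rat by rewrite ltr0n.
have x0 : 0 < x by rewrite invr_gt0 mulr_gt0.
have : \sum_(f in A) p%:R * x ^+ t <= 2 ^+ v.
  apply: (@le_trans _ _ (\sum_(f : {ffun 'I_v -> {set V}}) \prod_i ((#|f i|)`!%:R * x ^+ #|f i|))).
    rewrite [leLHS]big_mkcond /=; apply: ler_sum => f _; case: ifP => [|_].
      rewrite inE => /andP[/eqP<- /eqP<-].
      by rewrite big_split /= prodrXr -natr_prod.
    by apply: prodr_ge0 => i _; rewrite mulr_ge0 ?ler0n ?exprn_ge0 ?ltW.
  rewrite -(bigA_distr_bigA (fun=> fun S : {set V} => (#|S|)`!%:R * x ^+ #|S|)) prodr_const card_ord.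
  rewrite lerXn2r ?nnegrE //; first by apply: sumr_ge0 => S _; rewrite mulr_ge0 ?ler0n ?exprn_ge0 ?ltW.
  apply: sum_fact_sets_le2; first exact: ltW.
  by rewrite /x invfM mulrCA mulfV ?mulr1 // gt_eqF.
rewrite sumr_const -[leLHS]mulr_natl mulrA exprVn ler_pdivrMr ?exprn_gt0 ?mulr_gt0 //.
by rewrite -natrM -[2]/(2%:R) -natrM -!natrX -natrM ler_nat.
Qed.

End CodeCount.

(** * Forests as edge sets, and their copies *)

Section Copies.
Variable n : nat.
Implicit Types (F : forest 'I_n) (G H J : graph n).

(** A pair with equal entries contributes nothing, as edges have two elements. *)
Definition Eof (ps : seq ('I_n * 'I_n)) : graph n :=
  [set d : edge n | has (fun p => val d == [set p.1; p.2]) ps].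

Lemma eq_Eof ps ps' : ps =i ps' -> Eof ps = Eof ps'.
Proof. by move=> E; apply/setP => d; rewrite !inE (eq_has_r E). Qed.

Lemma adjP G u v :
  reflect (exists2 d, d \in G & val d = [set u; v]) (adj G u v).
Proof. by apply: (iffP exists_inP) => -[d dG /eqP]; exists d => //; apply/eqP. Qed.

Lemma adj_sym G : symmetric (adj G).
Proof. by move=> u v; apply: eq_existsb => d; rewrite setUC. Qed.

Lemma adj_irr G : irreflexive (adj G).
Proof.
move=> u; apply: negbTE; apply/negP => /adjP[d _ E].
by have := valP d; rewrite /= E setUid cards1.
Qed.

Lemma adj_mono G H u v : G \subset H -> adj G u v -> adj H u v.
Proof.
move=> /subsetP GH /adjP[d dG E]; apply/adjP; exists d => //.
exact: GH.
Qed.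

Lemma edge_pair (d : edge n) : exists u v, val d = [set u; v] /\ u != v.
Proof. by case/cards2P: (valP d) => u [v [uv E]]; exists u, v. Qed.

Lemma adj_vertices G u v : adj G u v -> (u \in vertices G) && (v \in vertices G).
Proof.
move=> /adjP[d dG E]; apply/andP.
by split; apply/bigcupP; exists d; rewrite // E !inE eqxx ?orbT.
Qed.

Lemma vertices_adj G u : u \in vertices G -> exists v, adj G u v.
Proof.
move=> /bigcupP[d dG]; have [a [b [E _]]] := edge_pair d.
rewrite E !inE => /orP[]/eqP->; [exists b|exists a]; apply/adjP; exists d => //.
by rewrite E setUC.
Qed.

Lemma graph_eq_adj G H : adj G =2 adj H -> G = H.
Proof.
move=> GH; apply/setP => d; have [a [b [E _]]] := edge_pair d.
have dG (K : graph n) : (d \in K) = adj K a b.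
  apply/idP/adjP => [dK|[d' d'K E']]; first by exists d.
  by have -> : d = d' by apply: val_inj; rewrite E -E'.
by rewrite !dG GH.
Qed.

Lemma set2_eq_cases (a b u v : 'I_n) : a != b -> [set a; b] = [set u; v] ->
  (u, v) = (a, b) \/ (v, u) = (a, b).
Proof.
move=> ab E; have /set2P au : a \in [set u; v] by rewrite -E set21.
have /set2P bu : b \in [set u; v] by rewrite -E set22.
case: au bu => [ae|ae] [be|be]; rewrite ae be ?eqxx // in ab *; first by left.
by right.
Qed.

Lemma adj_Eof ps u v : {in ps, forall p, p.1 != p.2} ->
  adj (Eof ps) u v = ((u, v) \in ps) || ((v, u) \in ps).
Proof.
move=> irr; apply/adjP/orP => [[d]|].
  rewrite inE => /hasP[[a b] abp /= /eqP->] E.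
  have ab := irr _ abp; rewrite /= in ab.
  by case: (set2_eq_cases ab E) => ->; [left|right].
have mk_edge a b : (a, b) \in ps -> exists2 d : edge n, d \in Eof ps & val d = [set a; b].
  move=> abp; have c2 : #|[set a; b]| == 2%N by rewrite cards2 (irr _ abp).
  exists (Sub [set a; b] c2); last by [].
  by rewrite inE; apply/hasP; exists (a, b).
by case=> /mk_edge[d dE E]; exists d; rewrite // E // setUC.
Qed.

Lemma uniq_tpairs_irr F : uniq (labels F) -> {in tpairs F, forall p, p.1 != p.2}.
Proof.
move=> UF [a b] abF /=; apply/eqP => E; subst b.
by have := tpairs_antisym UF abF; rewrite abF.
Qed.

Lemma card_Eof F : uniq (labels F) -> #|Eof (tpairs F)| = size (tpairs F).
Proof.
move=> UF; have irr := uniq_tpairs_irr UF.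
have c2 p : p \in tpairs F -> #|[set p.1; p.2]| == 2%N by move=> /irr pp; rewrite cards2 pp.
pose g p : {set 'I_n} := [set p.1; p.2].
have gi : {in tpairs F &, injective g}.
  move=> [a b] [c d] abF cdF; rewrite /g /= => E.
  case: (set2_eq_cases (irr _ abF) E) => // dcE; have := tpairs_antisym UF cdF.
  by rewrite dcE abF.
have Ut : uniq (tpairs F) by apply: map_uniq (uniq_tpairs UF).
rewrite -(card_imset _ val_inj) -(size_map g) -(card_uniqP _); last by rewrite map_inj_in_uniq.
apply: eq_card => X; apply/imsetP/mapP => [[d]|[p pF ->]].
  by rewrite inE => /hasP[p pF /eqP E] ->; exists p.
exists (Sub (g p) (c2 p pF)) => //.
by rewrite inE; apply/hasP; exists p.
Qed.

(** [nontrivial] makes every label a vertex of the graph, which is where an isomorphism is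
    injective. *)
Lemma isomorphic_Eof F J : uniq (labels F) -> nontrivial F ->
    isomorphic (Eof (tpairs F)) J ->
  exists2 g : 'I_n -> 'I_n, uniq (labels (fmap g F)) & J = Eof (tpairs (fmap g F)).
Proof.
move=> UF nF /existsP[g /and3P[/dinjectiveP ginj /eqP gV /forall_inP gadj]].
have irr := uniq_tpairs_irr UF.
have adjE u v : adj (Eof (tpairs F)) u v = ((u, v) \in tpairs F) || ((v, u) \in tpairs F).
  exact: adj_Eof.
have LV x : x \in labels F -> x \in vertices (Eof (tpairs F)).
  move=> /(nontrivial_cover nF)[[a b] abF].
  have : adj (Eof (tpairs F)) a b by rewrite adjE abF.
  by move=> /adj_vertices/andP[aV bV] /orP[]/eqP->.
have gi : {in labels F &, injective g}.
  by move=> x y xF yF; apply: ginj; apply: LV.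
have UgF : uniq (labels (fmap g F)) by rewrite labels_fmap map_inj_in_uniq.
exists g => //; apply: graph_eq_adj => a b.
rewrite adj_Eof; last exact: uniq_tpairs_irr.
rewrite tpairs_fmap; apply/idP/orP => [abJ|].
  have /andP[aJ bJ] := adj_vertices abJ.
  move: aJ bJ abJ; rewrite -gV => /imsetP[u uV ->] /imsetP[v vV ->].
  have /forall_inP/(_ v vV)/eqP<- := gadj u uV.
  by rewrite adjE => /orP[] h; [left|right]; apply/mapP; [exists (u, v)|exists (v, u)].
have H u v : (u, v) \in tpairs F -> adj J (g u) (g v).
  move=> uvF; have uvE : adj (Eof (tpairs F)) u v by rewrite adjE uvF.
  have /andP[uV vV] := adj_vertices uvE.
  by have /forall_inP/(_ v vV)/eqP<- := gadj u uV.
case=> /mapP[[u v] uvF [-> ->]]; first exact: H uvF.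
by rewrite adj_sym; exact: H uvF.
Qed.

(** A copy is determined by its set of roots and its code. The orderings of the roots complete the
    binomial coefficient to a falling factorial, and [card_codes_le] absorbs [fac F]. *)
Lemma N_forest_le F : uniq (labels F) -> nontrivial F -> (0 < n)%N ->
  (N (Eof (tpairs F)) (Kn n) * gfac F <=
   n ^ size (roots F) * (2 ^ size (labels F) * (2 * n) ^ size (tpairs F)))%N.
Proof.
move=> UF nF n0; set c := size (roots F); set v := size (labels F).
pose A := [set f : {ffun 'I_v -> {set 'I_n}} | (\prod_i (#|f i|)`! == fac F)%N &&
       (\sum_i #|f i| == size (tpairs F))%N].
pose B := [set S : {set 'I_n} | #|S| == c].
pose D (x : {set 'I_n} * {ffun 'I_v -> {set 'I_n}}) : graph n :=
  Eof (decode (enum x.1) (codom x.2)).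
have sub : copies (Eof (tpairs F)) (Kn n) \subset D @: setX B A.
  apply/subsetP => J; rewrite inE => /andP[_ /(isomorphic_Eof UF nF)[g UgF ->]].
  set G := fmap g F in UgF *.
  pose S := [set x in roots G].
  have pS : perm_eq (map fst (unmk G)) (enum S).
    rewrite -roots_mk unmkK; apply: uniq_perm; last by move=> x; rewrite mem_enum inE.
      apply: subseq_uniq UgF; elim: {S} G => //= w k1 _ s1 IH.
      by rewrite eqxx; apply: subseq_trans IH (suffix_subseq _ _).
    exact: enum_uniq.
  (* The roots are put in the order of [enum] too, so that the set [S] alone gives the initial
     stack. *)
  have [l pl El] := mk_perm pS; pose G' := mk l.
  have pL : perm_eq (labels G') (labels G).
    by rewrite -[in X in perm_eq _ X](unmkK G) !labels_mk perm_flatten // perm_map // perm_sym.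
  have pT : perm_eq (tpairs G') (tpairs G).
    by rewrite -[in X in perm_eq _ X](unmkK G) !tpairs_mk perm_flatten // perm_map // perm_sym.
  have fG : fac G' = fac F.
    by rewrite fac_mk -(perm_big _ pl) -fac_mk unmkK /G fac_fmap.
  have UG' : uniq (labels G') by rewrite (perm_uniq pL).
  have [cs [h1 h2 h3 h4]] := code_exists UG'.
  have scs : size cs = v by rewrite h1 (perm_size pL) /G labels_fmap size_map.
  pose f : {ffun 'I_v -> {set 'I_n}} := [ffun i => nth set0 cs (val i)].
  have fE : codom f = cs.
    rewrite codomE; apply: (@eq_from_nth _ set0); first by rewrite size_map size_enum_ord.
    move=> i; rewrite size_map size_enum_ord => iv.
    rewrite (nth_map (Ordinal iv)) ?size_enum_ord // ffunE.
    by rewrite /= nth_enum_ord.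
  have fbig (T : Type) (idx : T) (op : Monoid.com_law idx) (h : {set 'I_n} -> T) :
      \big[op/idx]_(i < v) h (f i) = \big[op/idx]_(S <- cs) h S.
    by rewrite -fE big_image.
  apply/imsetP; exists (S, f).
    rewrite inE /=; apply/andP; split; rewrite inE.
      by rewrite cardE -(perm_size pS) -roots_mk unmkK /G roots_fmap size_map.
    rewrite (fbig _ _ muln (fun S => (#|S|)`!)) (fbig _ _ addn (fun S => #|S|)).
    by rewrite h3 fG h4 (perm_size pT) /G tpairs_fmap size_map !eqxx.
  rewrite /D /= fE; apply: eq_Eof => p.
  by rewrite -El -roots_mk -(perm_mem pT) -(perm_mem h2).
have cA := card_codes_le v (size (tpairs F)) (fac F) (V := 'I_n).
rewrite card_ord -/A in cA.
apply: (@leq_trans (#|B| * #|A| * gfac F)).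
  rewrite leq_mul2r /N (leq_trans (subset_leq_card sub)) ?orbT //.
  by rewrite (leq_trans (leq_imset_card _ _)) // cardsX.
rewrite /gfac mulnACA leq_mul ?cA // card_draws card_ord bin_ffact.
exact: ffact_leq_expn.
Qed.

End Copies.

(** * Weak-type decomposition and the count for one component *)

Section Threshold.
Variables (R : realType) (V : finType) (e : rel V) (p : R).
Hypothesis p_gt0 : 0 < p.
Hypothesis gfac_le : forall F : forest V, valid e predT F -> uniq (labels F) ->
  nontrivial F ->
  (gfac F)%:R <= #|V|%:R ^+ size (roots F) * p ^+ size (tpairs F).

(* [U] is the vertex set of a maximal disjoint family of trees of weight at least
   [x]; the extra factor 4 in the weight pays for the sizes of the trees. *)
Lemma threshold_set (x : R) : 1 < x -> exists2 U : {set V},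
  #|U|%:R * x <= 2 * #|V|%:R &
  forall v, v \notin U -> wbound e (4 * p) v (v |: U) x.
Proof.
move=> x1; pose P := 4 * p; have P0 : 0 < P by rewrite mulr_gt0.
have x0 : 0 < x by lra.
pose heavy (F : forest V) :=
  all (fun t => x * P ^+ size (labels t.2) <= (gfac t.2)%:R) (unmk F).
pose good F := [&& valid e predT F, uniq (labels F) & heavy F].
have [F [gF Fmax]] : exists F, good F /\ forall v k, ~~ good (Cons v k F).
  have [m] := ubnP (#|V| - size (labels (@Nil V))); have : good Nil by [].
  elim: m Nil => // m IHm F gF Fm.
  have [[v [k gF']]|Fmax] := EM (exists v k, good (Cons v k F)); last first.
    by exists F; split=> // v k; apply/negP => h; apply: Fmax; exists v, k.
  apply: (IHm _ gF'); have /and3P[_ /card_uniqP cF' _] := gF'.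
  have := max_card (mem (labels (Cons v k F))); rewrite cF'; move: Fm; rewrite /= size_cat; lia.
have /and3P[vF UF hF] := gF.
have prodF : x ^+ size (roots F) * P ^+ size (tpairs F) <= (fac F)%:R.
  elim: F hF {vF UF gF Fmax} => [|v k _ s IHs] /=; first by rewrite !expr0 mulr1.
  case/andP=> hk /IHs hs; rewrite size_cat size_pairs exprD exprS mulrACA.
  by rewrite natrM ler_pM // mulr_ge0 ?exprn_ge0 // ltW.
(* A single vertex has weight 1, below [x]. *)
have nF : nontrivial F.
  apply: sub_all hF => -[v [|u k s]] //=; rewrite expr0 mulr1.
  by move=> /(lt_le_trans x1); rewrite ltxx.
exists [set v in labels F].
  have -> : #|[set v in labels F]| = size (labels F).
    by rewrite cardsE; apply/card_uniqP.
  have := gfac_le vF UF nF; have := nontrivial_size nF; have := size_tpairs F.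
  rewrite -mul2n; set c := size (roots F) in prodF *; set ee := size (tpairs F) in prodF *.
  move=> sz cc G; have ce : (c <= ee)%N by move: cc; rewrite -sz mul2n -addnn leq_add2l.
  have [c0|c0] := posnP c.
    by have -> : F = Nil by [move: c0; rewrite /c; case: (F)]; rewrite mul0r mulr_ge0.
  (* Taking c-th roots: c! x^c (4p)^ee is at most c! times [fac F], hence at most n^c p^ee, while
     ee^c is at most c! 4^ee as [c <= ee]. *)
  suff H : ee%:R * x <= #|V|%:R.
    have : (size (labels F))%:R <= 2 * ee%:R :> R by rewrite -natrM ler_nat.
    by move=> h; nra.
  rewrite -(ler_pXn2r c0) ?nnegrE ?mulr_ge0 ?ler0n //; last exact: ltW.
  have pe : 0 < p ^+ ee by rewrite exprn_gt0.
  rewrite -(ler_pM2r pe); apply: le_trans G.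
  rewrite /gfac natrM -/c; apply: le_trans (ler_wpM2l (ler0n _ _) prodF).
  rewrite exprMn /P exprMn mulrA mulrA ler_pM2r // mulrAC ler_pM2r ?exprn_gt0 //.
  by rewrite -!natrX -natrM ler_nat expn_le_fact_mul4.
move=> v; rewrite inE => vF' K /and3P[vK UK /allP aK].
(* A heavier tree at [v] would extend the maximal family. *)
rewrite leNgt; apply/negP => big; apply: (negP (Fmax v K)); apply/and3P; split.
- by rewrite /= vK vF.
- rewrite /= mem_cat negb_or vF' cat_uniq UK UF !andbT; apply/andP; split.
    by apply/negP => /aK; rewrite setU11.
  by apply/hasPn => w wF; apply/negP => /aK; rewrite !inE wF orbT.
- by rewrite /heavy /= (ltW big).
Qed.

End Threshold.

(** * Restrictions of embeddings to vertex sets *)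

Section Components.
Variables (V : finType) (a e : rel V).
Implicit Types (B Y : {set V}) (g : {ffun V -> V}) (K : forest V).

Definition embeddings : {set {perm V}} :=
  [set t : {perm V} | [forall x, forall y, a x y ==> e (t x) (t y)]].

Lemma embeddingsP (t : {perm V}) :
  reflect (forall x y, a x y -> e (t x) (t y)) (t \in embeddings).
Proof.
rewrite inE; apply: (iffP forallP) => [h x y|h x].
  by move/forallP: (h x) => /(_ y)/implyP.
by apply/forallP => y; apply/implyP/h.
Qed.

(** The fixed values off [B] make equality of restrictions mean agreement on [B]. *)
Definition restr B (f : V -> V) : {ffun V -> V} :=
  [ffun x => if x \in B then f x else x].

Definition partial B : {set {ffun V -> V}} :=
  [set restr B t | t : {perm V} in embeddings].

(** Two permutations with the same restriction differ by a permutation that fixes [B] pointwise. *)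
Lemma card_embeddings_le B :
  (#|embeddings| <= #|partial B| * (#|V| - #|B|)`!)%N.
Proof.
pose r (t : {perm V}) := restr B t.
rewrite -sum1_card (partition_big r (mem (partial B))) /=; last first.
  by move=> t te; apply: imset_f.
apply: leq_trans (_ : (\sum_(g in partial B) (#|V| - #|B|)`! <= _)%N); last first.
  by rewrite sum_nat_const.
apply: leq_sum => g gB; have /imsetP[t0 t0e gE] : g \in partial B by [].
rewrite sum1dep_card gE.
have -> : (#|V| - #|B|)%N = #|~: B| by rewrite -(cardsC B) addKn.
rewrite -card_perm.
rewrite -(card_imset _ (mulIg t0^-1%g)); apply: subset_leq_card.
apply/subsetP => s /imsetP[t]; rewrite inE => /andP[_ /eqP/ffunP E] {s}->.
apply/subsetP => x; rewrite !inE permM; apply: contraNN => xB.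
by have := E x; rewrite !ffunE xB => ->; rewrite permK.
Qed.

Lemma card_partialU B B' : (#|partial (B :|: B')| <= #|partial B| * #|partial B'|)%N.
Proof.
rewrite -cardsX; pose r g := (restr B g, restr B' g).
rewrite -(card_in_imset (f := r)).
  apply: subset_leq_card; apply/subsetP => _ /imsetP[_ /imsetP[t te ->] ->].
  have rE (D : {set V}) : D \subset B :|: B' -> restr D (restr (B :|: B') t) = restr D t.
    move=> /subsetP DB; apply/ffunP => x; rewrite !ffunE.
    by case: ifP => // /DB ->.
  by rewrite inE /= !rE ?subsetUl ?subsetUr // !imset_f.
move=> _ _ /imsetP[t te ->] /imsetP[t' te' ->] [/ffunP E /ffunP E'].
apply/ffunP => x; have := E x; have := E' x; rewrite !ffunE in_setU.
by case: (x \in B); case: (x \in B').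
Qed.

(** A restriction that sends [x] to [v] is determined by its values along [K], and these form a
    sequence counted by [cnt]. *)
Lemma card_partial_at B Y x K v :
    valid a (a x) K -> uniq (x :: labels K) -> B =i x :: labels K ->
  (#|[set g in partial B | (g x == v) && [disjoint g @: B & Y]]| <=
     cnt e K v (v |: Y))%N.
Proof.
move=> vK /= /andP[xK UK] BE; set X := [set g in _ | _].
pose l g := map g (labels K).
have XE g : g \in X -> exists2 t : {perm V}, t \in embeddings & [/\ g = restr B t, t x = v &
    forall y, y \in B -> t y \notin Y].
  rewrite inE => /and3P[/imsetP[t te ->] /eqP gx dis]; exists t => //.
  split=> //; first by move: gx; rewrite ffunE BE mem_head.
  move=> y yB; rewrite (disjointFr dis) //.
  by apply/imsetP; exists y; rewrite // ffunE yB.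
rewrite cardE -(size_map l); apply: uniq_leq_size.
  rewrite map_inj_in_uniq ?enum_uniq // => g g'; rewrite !mem_enum.
  move=> /XE[t _ [-> tx _]] /XE[t' _ [-> tx' _]] /eq_in_map E.
  apply/ffunP => y; have [yB|yB] := boolP (y \in B); last by rewrite !ffunE (negbTE yB).
  have := yB; rewrite BE inE => /orP[/eqP->|/E//].
  by rewrite !ffunE BE mem_head tx tx'.
move=> w /mapP[g]; rewrite mem_enum => /XE[t /embeddingsP te [-> tx tY]] {w}->.
have -> : l (restr B t) = labels (fmap t K).
  rewrite labels_fmap; apply/eq_in_map => y yK.
  by rewrite ffunE BE inE yK orbT.
apply: mem_emb.
- by apply: (valid_fmap te) vK => y; rewrite -tx; apply: te.
- by rewrite labels_fmap map_inj_uniq //; apply: perm_inj.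
rewrite labels_fmap => w /mapP[y yK {w}->]; rewrite !inE negb_or tY ?BE ?inE ?yK ?orbT // andbT.
by rewrite -tx (inj_eq perm_inj); apply: contraNneq xK => <-.
Qed.

Hypothesis a_sym : symmetric a.
Hypothesis a_irr : irreflexive a.
Hypothesis a_acyclic : forall c : seq V, (2 < size c)%N -> ~~ ucycleb a c.

Lemma explore_component x : exists K,
  [/\ valid a (a x) K, uniq (x :: labels K),
      [set y | connect a x y] =i x :: labels K,
      forall y z, y \in x :: labels K -> a y z ->
        (y, z) \in pairs x K \/ (z, y) \in pairs x K &
      forall F : forest V, (cnt a F x [set x] <= gfac K)%N].
Proof.
have [K [/and3P[vK UK /allP aK] sK cK]] := explore a_sym a_irr a_acyclic (set11 x).
have {}sK y z : y \in x :: labels K -> a y z -> (y, z) \in pairs x K \/ (z, y) \in pairs x K.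
  by move=> yK; apply: sK => //; rewrite setDv inE.
exists K; split=> //.
  by rewrite /= UK andbT; apply/negP => /aK; rewrite set11.
move=> y; rewrite inE; apply/idP/idP; last exact: valid_connect_e.
case/connectP => q; elim/last_ind: q y => [|q w IHq] y; first by move=> _ ->; rewrite mem_head.
rewrite rcons_path last_rcons => /andP[/IHq/(_ erefl) lK alw ->].
case: (sK _ _ lK alw) => /pairs_sub[/= h1 h2]; last by rewrite h1.
by rewrite inE h2 orbT.
Qed.

End Components.

Lemma card_bigcup_le (I T : finType) (P : pred I) (F : I -> {set T}) :
  (#|\bigcup_(i | P i) F i| <= \sum_(i | P i) #|F i|)%N.
Proof.
elim/big_rec2: _ => [|i m X _ IH]; first by rewrite cards0.
by rewrite (leq_trans (leq_card_setU _ _)) // leq_add2l.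
Qed.

(** * Summation over the level sets *)

Section ComponentCount.
Variables (R : realType) (V : finType) (a e : rel V) (p : R).
Hypotheses (a_sym : symmetric a) (a_irr : irreflexive a).
Hypothesis a_acyclic : forall c : seq V, (2 < size c)%N -> ~~ ucycleb a c.
Hypothesis e_sym : symmetric e.
Hypothesis e_acyclic : forall c : seq V, (2 < size c)%N -> ~~ ucycleb e c.

(** Any vertex can be the root; the root will be a vertex whose image lies in a given set. *)
Lemma component_tree x y : connect a x y -> exists K,
  [/\ valid a (a y) K, uniq (y :: labels K),
      [set z | connect a x z] =i y :: labels K &
      size (labels K) = #|[set z | connect a x z]|.-1].
Proof.
move=> xy; have [K [vK UK KE _ _]] := explore_component a_sym a_irr a_acyclic y.
have E : [set z | connect a x z] =i y :: labels K.
  by move=> z; rewrite -KE !inE; apply: same_connect => //; apply: sym_connect_sym.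
exists K; split=> //.
by rewrite (eq_card E) (card_uniqP UK).
Qed.

Lemma ln2_ge_half : 2^-1 <= ln 2 :> R.
Proof.
have -> : ln 2 = - ln (1 + - 2^-1) :> R.
  rewrite -lnV ?posrE; last by lra.
  by congr ln; field.
by rewrite lerNr; apply: le_ln1Dx; lra.
Qed.

(** The quotient by [2 ^+ j.+1] is of order 1 / j^2, written as a telescoping difference. *)
Lemma damp_double_le (j : nat) :
  damp (2 ^+ j.+2) <= 2 ^+ j.+1 * (32 * (j.+1%:R^-1 - j.+2%:R^-1)) :> R.
Proof.
rewrite /damp [2 ^+ j.+2]exprS [2 * _]mulrC -mulrA ler_pM2l ?exprn_gt0 //.
have j1 : 1 <= j.+1%:R :> R by rewrite ler1n.
have -> : j.+2%:R = j.+1%:R + 1 :> R by rewrite -natr1.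
have l2 : (j.+1%:R + 1) / 4 <= 1 + ln (2 ^+ j.+1 * 2) / 2 :> R.
  rewrite -exprSr lnXn // -[leRHS]/(1 + (ln 2 *+ j.+2) / 2) -mulr_natr -natr1.
  have := ln2_ge_half; nra.
set y := _%:R in j1 l2 *; set z := 1 + _ in l2 *.
have z0 : 0 < z by lra.
rewrite ler_pdivrMr ?exprn_gt0 //.
have -> : 32 * (y^-1 - (y + 1)^-1) * z ^+ 2 = (32 * z ^+ 2) / (y * (y + 1)).
  by field; apply/andP; split; apply: lt0r_neq0; lra.
rewrite ler_pdivlMr; last by rewrite mulr_gt0; lra.
nra.
Qed.

Hypothesis p_ge : 1 <= 4 * p.
Hypothesis gfac_le : forall F : forest V, valid e predT F -> uniq (labels F) ->
  nontrivial F ->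
  (gfac F)%:R <= #|V|%:R ^+ size (roots F) * p ^+ size (tpairs F).

Lemma card_partial_component x : let B := [set y | connect a x y] in
  (1 < #|B|)%N ->
  #|partial a e B|%:R <= #|V|%:R * (132 * (160 * (4 * p))) ^+ (#|B|).-1.
Proof.
have aux (y : R) : 0 <= y -> 2 + 64 * (1 - y) <= 66 by move=> y0; lra.
move=> B B1; have p1 := p_ge; have p0 : 0 < p by lra.
set t := (#|B|).-1; have Bt : #|B| = t.+1 by rewrite prednK // ltnW.
have t1 : (1 <= t)%N by rewrite -ltnS -Bt.
have x2 (j : nat) : 1 < 2 ^+ j.+1 :> R by rewrite exprn_egt1 // ltr1n.
have exU : forall j : nat, exists U : {set V},
    #|U|%:R * 2 ^+ j.+1 <= 2 * #|V|%:R :> R /\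
    forall v, v \notin U -> wbound e (4 * p) v (v |: U) (2 ^+ j.+1).
  by move=> j; have [U] := threshold_set p0 gfac_le (x2 j); exists U.
have [U HU] := choice exU.
pose A := (160 * (4 * p)) ^+ t.
have A0 : 0 <= A by rewrite exprn_ge0 //; lra.
pose X (Y : {set V}) := [set g in partial a e B | [disjoint g @: B & Y]].
(* If [v] is in [U j], there is nothing to count. Otherwise the component is rooted at [y] and the
   pointwise bound applies with [M = 2 ^+ j.+1]. *)
have at_le y v (j : nat) : y \in B ->
    #|[set g in partial a e B | (g y == v) && [disjoint g @: B & U j]]|%:R
      <= A * damp (2 ^+ j.+1).
  move=> yB; have [vU|vU] := boolP (v \in U j).
    rewrite [_ %:R](_ : _ = 0); first by rewrite mulr_ge0 // ltW // damp_gt0 // ltW.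
    apply/eqP; rewrite pnatr_eq0 cards_eq0 -subset0; apply/subsetP => g.
    rewrite inE => /and3P[_ /eqP gy dis]; rewrite -gy in vU.
    by rewrite (disjointFr dis) ?imset_f in vU.
  have := yB; rewrite inE => /component_tree[K [vK UK KE sK]].
  apply: le_trans (_ : (cnt e K v (v |: U j))%:R <= _).
    by rewrite ler_nat; apply: card_partial_at vK UK KE.
  have [_ /(_ v vU) w] := HU j.
  have -> : A = (160 * (4 * p)) ^+ size (labels K) by rewrite sK.
  by apply: pointwise_bound => //; [exact: setU11 | exact: ltW].
(* The 2 bounds [damp 2], and 64 is 2 * 32, from the size of [U j] and from [damp_double_le]. *)
have step (j : nat) : #|X (U j)|%:R <=
    t.+1%:R * A * #|V|%:R * (2 + 64 * (1 - j.+1%:R^-1)).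
  elim: j => [|j IHj].
    have xB : x \in B by rewrite inE connect0.
    have sub : X (U 0%N) \subset \bigcup_v
        [set g in partial a e B | (g x == v) && [disjoint g @: B & U 0%N]].
      apply/subsetP => g; rewrite inE => /andP[gE dis].
      by apply/bigcupP; exists (g x); rewrite // inE gE eqxx.
    apply: (@le_trans _ _ (\sum_(v : V) A * damp (2 ^+ 1))).
      apply: (@le_trans _ _ (\sum_(v : V) (#|[set g in partial a e B |
         (g x == v) && [disjoint g @: B & U 0%N]]|)%:R)); last by apply: ler_sum => v _; apply: at_le.
      rewrite -natr_sum ler_nat (leq_trans (subset_leq_card sub)) //.
      exact: card_bigcup_le.
    rewrite sumr_const -[leLHS]mulr_natr invr1 subrr mulr0 addr0.
    have d2 : damp (2 ^+ 1) <= 2 :> R.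
      rewrite expr1 /damp ler_pdivrMr; last by rewrite damp_den_sqr_gt0 // ler1n.
      by rewrite ler_peMr // exprn_ege1 //; have := ln2_ge_half; lra.
    have t0 : 1 <= t.+1%:R :> R by rewrite ler1n.
    apply: (@le_trans _ _ (A * 2 * #|V|%:R)).
      by rewrite ler_wpM2r ?ler0n // ler_wpM2l.
    rewrite [leRHS](_ : _ = (A * 2 * #|V|%:R) * t.+1%:R); last by ring.
    by rewrite ler_peMr // !mulr_ge0 ?ler0n.
  (* An embedding that avoids [U j.+1] but meets [U j] sends some [y] of [B] to some [v] of
     [U j]. *)
  have sub : X (U j.+1) \subset X (U j) :|: \bigcup_(i in setX B (U j))
      [set g in partial a e B | (g i.1 == i.2) && [disjoint g @: B & U j.+1]].
    apply/subsetP => g; rewrite inE => /andP[gE dis].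
    rewrite in_setU inE gE /=; case: (boolP [disjoint _ & U j]) => //= /pred0Pn[v /= /andP[]].
    case/imsetP=> y yB -> gU; apply/bigcupP; exists (y, g y); first by rewrite inE yB.
    by rewrite inE gE eqxx.
  have : #|X (U j.+1)|%:R <= #|X (U j)|%:R +
      \sum_(i in setX B (U j)) A * damp (2 ^+ j.+2).
    apply: (@le_trans _ _ (#|X (U j)|%:R + \sum_(i in setX B (U j)) (#|[set g in partial a e B |
         (g i.1 == i.2) && [disjoint g @: B & U j.+1]]|)%:R)).
      rewrite -natr_sum -natrD ler_nat (leq_trans (subset_leq_card sub)) //.
      rewrite (leq_trans (leq_card_setU _ _)) // leq_add2l.
      exact: (card_bigcup_le (mem (setX B (U j)))).
    by rewrite lerD2l; apply: ler_sum => -[y v]; rewrite inE => /andP[yB _]; apply: at_le.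
  rewrite sumr_const cardsX Bt => /le_trans; apply.
  rewrite -[A * _ *+ _]mulr_natr natrM.
  set d : R := j.+1%:R^-1 - j.+2%:R^-1.
  have d0 : 0 <= d.
    by rewrite subr_ge0 lef_pV2 ?posrE ?ltr0n // ler_nat.
  have [HUj _] := HU j.
  have -> : t.+1%:R * A * #|V|%:R * (2 + 64 * (1 - j.+2%:R^-1)) =
     t.+1%:R * A * #|V|%:R * (2 + 64 * (1 - j.+1%:R^-1)) +
     t.+1%:R * A * (2 * #|V|%:R) * (32 * d) by rewrite /d; ring.
  apply: lerD IHj _; rewrite [leLHS](_ : _ =
     t.+1%:R * A * (#|U j|%:R * damp (2 ^+ j.+2))); last by ring.
  rewrite -[leRHS]mulrA; apply: ler_wpM2l; first by rewrite mulr_ge0 ?ler0n.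
  apply: (@le_trans _ _ (#|U j|%:R * 2 ^+ j.+1 * (32 * d))).
    by rewrite -mulrA; apply: ler_wpM2l (damp_double_le j); rewrite ler0n.
  by apply: ler_wpM2r HUj; rewrite mulr_ge0.
have [U0 _] := HU #|V|.
(* At this level the size bound is below 1, so the sum stops and every embedding is counted. *)
have UV : U #|V| = set0.
  apply/eqP; rewrite -cards_eq0 -leqn0 leqNgt; apply/negP => u0.
  have : (2 ^ #|V|.+1 <= 2 * #|V|)%N.
    rewrite -(ler_nat R) natrX natrM; apply: le_trans U0.
    by rewrite ler_peMl ?exprn_ge0 // ler1n.
  by rewrite expnS leq_pmul2l // leqNgt ltn_expl.
have XE : X (U #|V|) = partial a e B.
  by apply/setP => g; rewrite inE UV -setI_eq0 setI0 eqxx andbT.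
rewrite -XE; apply: le_trans (step _) _.
(* The base 132 is 66 * 2, attained at [t = 1]. *)
have t66 : 66 * t.+1%:R <= 132 ^+ t :> R.
  rewrite -natrM -natrX ler_nat; case: t t1 {Bt A A0 X at_le step XE} => // t _.
  by elim: t => // t IHt; rewrite expnS; lia.
rewrite exprMn -/A [leRHS](_ : _ = #|V|%:R * A * 132 ^+ t); last by ring.
have NA : 0 <= #|V|%:R * A by rewrite mulr_ge0 ?ler0n.
apply: le_trans (ler_wpM2l NA t66).
rewrite [leLHS](_ : _ = #|V|%:R * A * (t.+1%:R * (2 + 64 * (1 - #|V|.+1%:R^-1)))); last by ring.
apply: ler_wpM2l => //; rewrite mulrC; apply: ler_wpM2r; first exact: ler0n.
by apply: aux; rewrite invr_ge0 ler0n.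
Qed.

End ComponentCount.

(** * Random copies as random permutations *)

Lemma perm_extend (T : finType) (B : {set T}) (f : T -> T) :
  {in B &, injective f} -> exists s : {perm T}, {in B, s =1 f}.
Proof.
move=> finj; pose l := enum (~: B); pose l' := enum (~: (f @: B)).
have ll' : size l = size l'.
  rewrite -!cardE; apply/eqP; rewrite -(eqn_add2l #|B|) cardsC.
  by rewrite -(card_in_imset finj) cardsC.
pose s x := if x \in B then f x else nth x l' (index x l).
have il x : x \notin B -> (index x l < size l')%N.
  by move=> xB; rewrite -ll' index_mem mem_enum inE.
have sl x : x \notin B -> s x \notin f @: B.
  move=> xB; rewrite /s (negbTE xB); have := mem_nth x (il x xB).
  by rewrite mem_enum inE.
have sinj : injective s.
  move=> x y; case: (boolP (x \in B)) (boolP (y \in B)) => xB [] yB E.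
  - by move: E; rewrite /s xB yB; apply: finj.
  - by have := sl y yB; rewrite -E /s xB imset_f.
  - by have := sl x xB; rewrite E /s yB imset_f.
  move: E; rewrite /s (negbTE xB) (negbTE yB) (set_nth_default x y (il y yB)) => /eqP.
  rewrite nth_uniq ?il ?enum_uniq // => /eqP E.
  rewrite -(nth_index x (_ : x \in l)) ?mem_enum ?inE // E nth_index ?mem_enum ?inE //.
by exists (perm sinj) => x xB; rewrite permE /s xB.
Qed.

(** * Images of a graph under permutations *)

Section PermGraph.
Variable n : nat.
Implicit Types (G H J A : graph n) (s t : {perm 'I_n}).

Definition gmap t G : graph n :=
  Eof [seq p <- enum {: 'I_n * 'I_n} | adj G (t^-1%g p.1) (t^-1%g p.2)].

Lemma adj_gmap t G u v : adj (gmap t G) u v = adj G (t^-1%g u) (t^-1%g v).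
Proof.
rewrite adj_Eof.
  by rewrite mem_filter mem_enum mem_filter mem_enum /= !andbT [X in _ || X]adj_sym orbb.
case=> a b; rewrite mem_filter /= => /andP[ab _]; apply: contraTneq ab => ->.
by rewrite adj_irr.
Qed.

Lemma gmapM s t G : gmap (s * t)%g G = gmap t (gmap s G).
Proof. by apply: graph_eq_adj => u v; rewrite !adj_gmap invMg !permM. Qed.

Lemma gmap1 G : gmap 1%g G = G.
Proof. by apply: graph_eq_adj => u v; rewrite adj_gmap invg1 !perm1. Qed.

Lemma sub_adj A G : (A \subset G) = [forall u, forall v, adj A u v ==> adj G u v].
Proof.
apply/idP/idP => [AG|/forallP h].
  by apply/forallP => u; apply/forallP => v; apply/implyP/adj_mono.
apply/subsetP => d dA; have [u [v [E uv]]] := edge_pair d.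
have /forallP/(_ v)/implyP := h u; case/(_ _)/adjP; first by apply/adjP; exists d.
by move=> d' d'G E'; have -> : d = d' by apply: val_inj; rewrite E.
Qed.

Lemma sub_gmap A G t : (A \subset gmap t G) = (t^-1%g \in embeddings (adj A) (adj G)).
Proof.
rewrite sub_adj inE; apply: eq_forallb => u; apply: eq_forallb => v.
by rewrite adj_gmap.
Qed.

(** An isomorphism is injective on the vertices of [H], so it extends to a permutation by
    [perm_extend]. *)
Lemma copiesE H J : (J \in copies H (Kn n)) = [exists t, J == gmap t H].
Proof.
rewrite inE subsetT /=; apply/existsP/existsP => [[f]|[t /eqP->]].
  case/and3P=> /dinjectiveP finj /eqP fV /forall_inP fadj.
  have [t tf] := perm_extend finj; exists t; apply/eqP/graph_eq_adj => u v.
  rewrite adj_gmap; apply/idP/idP => [uvJ|uvH].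
    have /andP[] := adj_vertices uvJ; rewrite -fV => /imsetP[x xV ux] /imsetP[y yV vy].
    have /forall_inP/(_ y yV)/eqP := fadj x xV.
    by rewrite -ux -vy uvJ ux vy -!tf // !permK => ->.
  have /andP[xV yV] := adj_vertices uvH.
  have /forall_inP/(_ _ yV)/eqP := fadj _ xV.
  by rewrite uvH -!tf // !permKV.
exists (finfun t); have vE : vertices (gmap t H) = t @: vertices H.
  apply/setP => u; apply/idP/imsetP => [/vertices_adj[v]|[x /vertices_adj[y xy] ->]].
    rewrite adj_gmap => /adj_vertices/andP[uV _].
    by exists (t^-1%g u); rewrite ?permKV.
  have : adj (gmap t H) (t x) (t y) by rewrite adj_gmap !permK.
  by move=> /adj_vertices/andP[].
apply/and3P; split.
- by apply/dinjectiveP => x y _ _; rewrite !ffunE; apply: perm_inj.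
- by rewrite vE; apply/eqP/eq_imset => x; rewrite ffunE.
- apply/forall_inP => u _; apply/forall_inP => v _.
  by rewrite !ffunE adj_gmap !permK.
Qed.

Definition stab H : {set {perm 'I_n}} := [set t | gmap t H == H].

(** Each copy is the image of [H] under exactly one coset of the stabiliser. *)
Lemma card_gmap_in H (X : {set graph n}) : X \subset copies H (Kn n) ->
  #|[set t | gmap t H \in X]| = (#|X| * #|stab H|)%N.
Proof.
move=> /subsetP XH; rewrite -sum1_card (partition_big (fun t => gmap t H) (mem X)) /=.
  rewrite -sum_nat_const; apply: eq_bigr => J JX.
  have := XH J JX; rewrite copiesE => /existsP[t0 /eqP J0].
  rewrite sum1dep_card -[RHS](card_imset _ (mulIg t0)).
  apply: eq_card => t; rewrite [LHS]inE inE; apply/idP/imsetP => [/andP[_ /eqP tJ]|[s]].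
    exists (t * t0^-1)%g; last by rewrite mulgKV.
    by rewrite inE gmapM tJ J0 -gmapM mulgV gmap1.
  by rewrite inE => /eqP sH ->; rewrite gmapM sH -J0 JX eqxx.
by move=> t; rewrite inE.
Qed.

(** By [sub_gmap], the inverses of the embeddings are the permutations whose image of [H] contains
    [A]. These, and all n! permutations, cover each copy concerned [#|stab H|] times. *)
Lemma pr_nu (R : realType) H A :
  pr (nu R H) [set S : graph n | A \subset S] =
  #|embeddings (adj A) (adj H)|%:R / n`!%:R.
Proof.
set X := [set J in copies H (Kn n) | A \subset J].
have XH : X \subset copies H (Kn n) by apply/subsetP => J; rewrite inE => /andP[].
have eX : #|embeddings (adj A) (adj H)| = (#|X| * #|stab H|)%N.
  rewrite -(card_gmap_in XH) -[LHS](card_imset _ (@invg_inj {perm 'I_n})).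
  apply: eq_card => t; rewrite [RHS]inE [RHS]inE sub_gmap; apply/imsetP/idP => [[s sE ->]|/andP[_ tE]].
    by rewrite invgK sE andbT copiesE; apply/existsP; exists s^-1%g.
  by exists t^-1%g; rewrite ?invgK.
have eN : n`! = (#|copies H (Kn n)| * #|stab H|)%N.
  rewrite -(card_gmap_in (subxx _)) -card_Sn -cardsT; apply: eq_card => t.
  by rewrite [LHS]inE [RHS]inE copiesE; apply/esym/existsP; exists t.
have s0 : (0 < #|stab H|)%N.
  by apply/card_gt0P; exists 1%g; rewrite inE gmap1.
rewrite eX eN !natrM -mulf_div divff ?mulr1 ?pnatr_eq0 -?lt0n //.
rewrite /pr (eq_bigr (fun x => if x \in copies H (Kn n) then (#|copies H (Kn n)|%:R)^-1 else 0)); last first.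
  by move=> J _; rewrite /nu /= ffunE.
rewrite -big_mkcondr /= sumr_const -[LHS]mulr_natl; congr (_%:R * _); apply: eq_card => J.
by rewrite unfold_in /= [RHS]inE inE andbC.
Qed.

End PermGraph.

(** * The spread bound *)

Section Spread.
Variables (R : realType) (n : nat) (H : graph n).
Hypothesis H_neq0 : H != set0.
Hypothesis H_acyclic : acyclic H.

Lemma N_gt0 (I : graph n) : (0 < N I (Kn n))%N.
Proof. by apply/card_gt0P; exists I; apply: mem_copies. Qed.

Lemma q_ge_term (I : graph n) : I != set0 -> I \subset H ->
  (N I (Kn n))%:R `^ (- #|I|%:R^-1) <= q R H.
Proof.
move=> I0 IH; rewrite /q.
by apply: (le_bigmax_cond 0 (fun J : graph n => (N J (Kn n))%:R `^ (- #|J|%:R^-1)));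
  rewrite I0.
Qed.

Lemma q_gt0 : 0 < q R H.
Proof.
apply: lt_le_trans (q_ge_term H_neq0 (subxx H)).
by rewrite powR_gt0 // ltr0n N_gt0.
Qed.

Lemma q_exp_ge1 (I : graph n) : I != set0 -> I \subset H ->
  1 <= q R H ^+ #|I| * (N I (Kn n))%:R.
Proof.
move=> I0 IH; have N0 : 0 < (N I (Kn n))%:R :> R by rewrite ltr0n N_gt0.
have i0 : (0 < #|I|)%N by rewrite card_gt0.
rewrite -ler_pdivrMr // mul1r.
apply: (@le_trans _ _ (((N I (Kn n))%:R `^ (- #|I|%:R^-1)) ^+ #|I|)).
  rewrite -powR_mulrn ?powR_ge0 // -powRrM mulNr mulVf ?pnatr_eq0 -?lt0n //.
  by rewrite powR_inv1 // ltW.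
by rewrite lerXn2r ?nnegrE ?powR_ge0 ?q_ge_term // ltW // q_gt0.
Qed.

Lemma n_gt0 : (0 < n)%N.
Proof.
have /set0Pn[d _] := H_neq0; have [u _] := edge_pair d.
exact: leq_ltn_trans (leq0n u) (ltn_ord u).
Qed.

(** The [p] of the weights. The 8 is 4 * 2: at most 2t labels give [4 ^ t], and the codes give
    [(2 * n) ^ t]. *)
Definition scale : R := 8 * n%:R * q R H.

Lemma scale_gt0 : 0 < scale.
Proof. by rewrite !mulr_gt0 ?ltr0n ?n_gt0 ?q_gt0. Qed.

Lemma Eof_sub (F : forest 'I_n) : valid (adj H) predT F -> Eof (tpairs F) \subset H.
Proof.
move=> vF; apply/subsetP => d; rewrite inE => /hasP[[a b] abF /eqP E].
have /adjP[d' d'H E'] := valid_tpairs vF abF.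
by have -> : d = d' by apply: val_inj; rewrite E E'.
Qed.

(** Combines the upper bound of [N_forest_le] with [1 <= q ^ t * N], which is the definition of [q]
    at this subgraph. *)
Lemma gfac_forest_le (F : forest 'I_n) :
    valid (adj H) predT F -> uniq (labels F) -> nontrivial F ->
  (gfac F)%:R <= #|'I_n|%:R ^+ size (roots F) * scale ^+ size (tpairs F) :> R.
Proof.
move=> vF UF nF; rewrite card_ord; set c := size (roots F); set t := size (tpairs F).
have [t0|t0] := posnP t.
  have : (size (labels F) <= 0)%N by have := nontrivial_size nF; rewrite -/t t0.
  by rewrite /c t0; case: (F) => // _; rewrite /gfac /= !mulr1.
set I := Eof (tpairs F); have It : #|I| = t by apply: card_Eof.
have I0 : I != set0 by rewrite -card_gt0 It.
have := q_exp_ge1 I0 (Eof_sub vF); rewrite It => qN.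
have := N_forest_le UF nF n_gt0; rewrite -/I -/c -/t.
move: (gfac F) => G.
have sz : (size (labels F) <= 2 * t)%N by rewrite mul2n; apply: nontrivial_size.
move=> /leq_trans/(_ (leq_mul (leqnn _) (leq_mul (leq_pexp2l (isT : 0 < 2)%N sz) (leqnn _)))).
rewrite expnM -expnMn -(ler_nat R) !natrM !natrX => NF.
apply: (@le_trans _ _ (q R H ^+ t * (N I (Kn n))%:R * G%:R)).
  by rewrite ler_peMl ?ler0n.
rewrite -mulrA; apply: le_trans (ler_wpM2l (exprn_ge0 t (ltW q_gt0)) NF) _.
rewrite mulrCA /scale [8 * _ * _]mulrC exprMn ler_wpM2l ?exprn_ge0 ?ler0n //.
rewrite ler_wpM2l ?exprn_ge0 ?(ltW q_gt0) //.
by rewrite le_eqVlt; apply/orP; left; apply/eqP; congr (_ ^+ _); rewrite !natrM; ring.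
Qed.

Hypothesis H_connected : connected_graph H.

Section Fixed.
Variable A : graph n.
Variable t0 : {perm 'I_n}.
Hypothesis t0_emb : t0 \in embeddings (adj A) (adj H).

Lemma A_acyclic : acyclic A.
Proof.
move=> c c2; apply/negP => /andP[cA Uc].
have /negP := @H_acyclic (map t0 c) (etrans (congr1 _ (size_map _ _)) c2); apply.
apply/andP; split; last by rewrite map_inj_uniq //; apply: perm_inj.
case: c {c2 Uc} cA => //= x c; rewrite -map_rcons.
by apply: homo_path => u v; move/embeddingsP: t0_emb; apply.
Qed.

Let comp x := [set y | connect (adj A) x y].

Lemma vertices_embedding x t : x \in vertices A ->
  t \in embeddings (adj A) (adj H) -> t x \in vertices H.
Proof.
by move=> /vertices_adj[y xy] /embeddingsP/(_ _ _ xy)/adj_vertices/andP[].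
Qed.

Lemma comp_gt1 x : x \in vertices A -> (1 < #|comp x|)%N.
Proof.
move=> /vertices_adj[y xy]; apply/card_gt1P; exists x, y.
split; rewrite ?inE ?connect0 ?connect1 //.
by apply: contraTneq xy => ->; rewrite adj_irr.
Qed.

Lemma comp_sub x : x \in vertices A -> comp x \subset vertices A.
Proof.
move=> xA; apply/subsetP => y; rewrite inE => /connectP[c cP ->] {y}.
elim: c x xA cP => //= y c IHc x _ /andP[/adj_vertices/andP[_ yA]]; exact: IHc.
Qed.

(** As [H] is connected, the search tree from any [v] spans it and has [s] edges, so there are at
    most [n * scale ^ s] embeddings rooted at [v]. The [s + 1 <= 2 ^ s] choices of [v] give the 2,
    and [s] may be lowered to the number of edges of the component since [2 * scale <= 1]. *)
Lemma card_partial_small x : 2 * scale <= 1 -> x \in vertices A ->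
  #|partial (adj A) (adj H) (comp x)|%:R <= n%:R * (2 * scale) ^+ (#|comp x|).-1.
Proof.
move=> p2 xA; have p0 := scale_gt0.
have [K [vK UK KE sK]] := component_tree (@adj_sym _ A) (@adj_irr _ A) A_acyclic (connect0 (adj A) x).
set t := _.-1; set s := #|vertices H|.-1.
have Bx := comp_gt1 xA.
have VH0 : (#|comp x| <= #|vertices H|)%N.
  rewrite -(card_imset (comp x) (@perm_inj _ t0)); apply: subset_leq_card.
  apply/subsetP => z /imsetP[y yB {z}->]; apply: vertices_embedding => //.
  exact: (subsetP (comp_sub xA)).
have VH : #|vertices H| = s.+1 by rewrite prednK // (leq_trans _ VH0) // ltnW.
have cnt_le v : v \in vertices H ->
    (cnt (adj H) K v (v |: set0))%:R <= n%:R * scale ^+ s.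
  move=> vH; rewrite setU0.
  have [L [vL UL LE _ cL]] := explore_component (@adj_sym _ H) (@adj_irr _ H) H_acyclic v.
  apply: (@le_trans _ _ (gfac L)%:R); first by rewrite ler_nat.
  have LV : [set y | connect (adj H) v y] = vertices H.
    apply/setP => y; rewrite inE; apply/idP/idP => [/connectP[c cP ->]|]; last exact: H_connected.
    elim: c v vH cP {vL UL LE cL} => //= w c IHc v _ /andP[/adj_vertices/andP[_ wH]]; exact: IHc.
  have sL : size (labels L) = s.
    by rewrite /s -LV (eq_card LE) (card_uniqP UL).
  have s0 : (0 < s)%N by rewrite -ltnS -VH (leq_trans Bx).
  have vF : valid (adj H) predT (Cons v L Nil) by rewrite /= vL.
  have UF : uniq (labels (Cons v L Nil)) by move: UL; rewrite /= cats0.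
  have nF : nontrivial (Cons v L Nil) by rewrite /nontrivial /= sL s0.
  have := gfac_forest_le vF UF nF.
  by rewrite card_ord /= cats0 size_pairs sL expr1 /gfac /= muln1 mul1n.
have sub : partial (adj A) (adj H) (comp x) \subset \bigcup_(v in vertices H)
    [set g in partial (adj A) (adj H) (comp x) | (g x == v) && [disjoint g @: comp x & (set0 : {set 'I_n})]].
  apply/subsetP => g gB; have /imsetP[t' t'e gE] := gB.
  apply/bigcupP; exists (g x); last by rewrite inE gB eqxx -setI_eq0 setI0 eqxx.
  by rewrite gE ffunE inE connect0; apply: vertices_embedding.
apply: (@le_trans _ _ (\sum_(v in vertices H) n%:R * scale ^+ s)).
  apply: (@le_trans _ _ (\sum_(v in vertices H) (cnt (adj H) K v (v |: set0))%:R)); last first.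
    by apply: ler_sum => v; apply: cnt_le.
  rewrite -natr_sum ler_nat (leq_trans (subset_leq_card sub)) //.
  apply: leq_trans (card_bigcup_le _ _) _; apply: leq_sum => v _.
  exact: card_partial_at vK UK KE.
rewrite sumr_const VH -[leLHS]mulr_natr -mulrA ler_wpM2l ?ler0n //.
apply: (@le_trans _ _ ((2 * scale) ^+ s)).
  rewrite [leRHS]exprMn [leLHS]mulrC ler_wpM2r ?exprn_ge0 ?(ltW p0) // -natrX ler_nat.
  exact: ltn_expl.
apply: ler_wiXn2l => //; first by rewrite mulr_ge0 // ltW.
by rewrite -ltnS -VH /t prednK // ltnW.
Qed.

Lemma card_partial_comp x : x \in vertices A ->
  #|partial (adj A) (adj H) (comp x)|%:R <=
    n%:R * (132 * (160 * (4 * scale))) ^+ (#|comp x|).-1.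
Proof.
move=> xA; have p0 := scale_gt0.
have [p1|p1] := leP 1 (4 * scale).
  have := card_partial_component (@adj_sym _ A) (@adj_irr _ A) A_acyclic
    (@adj_sym _ H) H_acyclic p1 gfac_forest_le (comp_gt1 xA).
  by rewrite card_ord.
apply: le_trans (card_partial_small _ xA) _; first by lra.
rewrite ler_wpM2l ?ler0n // lerXn2r ?nnegrE //; lra.
Qed.

(** [w] counts the vertices of [A] and [c] its components. The component bounds are multiplied, and
    the other [n - w] vertices are permuted freely. *)
Lemma card_embeddings_bound :
  exists w c : nat, [/\ (w = #|A| + c)%N, (c <= #|A|)%N, (w <= n)%N &
  #|embeddings (adj A) (adj H)|%:R <=
    n%:R ^+ c * (132 * (160 * (4 * scale))) ^+ #|A| * (n - w)`!%:R].
Proof.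
have a_csym : connect_sym (adj A) by apply/sym_connect_sym/adj_sym.
have /fin_all_exists[K HK] : forall x : 'I_n, exists K, 
    [/\ valid (adj A) (adj A x) K, uniq (x :: labels K),
      comp x =i x :: labels K &
      forall y z, y \in x :: labels K -> adj A y z ->
        (y, z) \in pairs x K \/ (z, y) \in pairs x K].
  move=> x; have [K [h1 h2 h3 h4 _]] := explore_component (@adj_sym _ A) (@adj_irr _ A) A_acyclic x.
  by exists K.
(* One representative per component; [F] is then a spanning forest of [A]. *)
pose T := [set x in vertices A | fingraph.root (adj A) x == x].
pose F := mk [seq (x, K x) | x <- enum T].
have TA x : x \in T -> x \in vertices A by rewrite inE => /andP[].
have UF : uniq (labels F).
  rewrite labels_mk -map_comp; apply: uniq_flatten_map; first exact: enum_uniq.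
    by move=> x _; have [] := HK x.
  move=> x y z; rewrite !mem_enum /= => xT yT.
  have [_ _ <- _] := HK x; have [_ _ <- _] := HK y.
  move: xT yT; rewrite !inE => /andP[_ /eqP xr] /andP[_ /eqP yr] xz yz.
  by rewrite -xr -yr; apply/eqP; rewrite root_connect // (connect_trans xz) // a_csym.
have EF : Eof (tpairs F) = A.
  have irr := uniq_tpairs_irr UF.
  apply: graph_eq_adj => u v; rewrite adj_Eof //.
  have tF p : reflect (exists2 x, x \in T & p \in pairs x (K x)) (p \in tpairs F).
    rewrite tpairs_mk -map_comp; apply: (iffP flatten_mapP) => -[x xT px]; exists x => //.
      by move: xT; rewrite mem_enum.
    by rewrite mem_enum.
  apply/orP/idP => [|uv].
    case=> /tF[x xT]; have [vK _ _ _] := HK x => /(valid_pairs vK) //.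
    by rewrite adj_sym.
  have /andP[uA _] := adj_vertices uv.
  pose x := fingraph.root (adj A) u; have ux : connect (adj A) u x by apply: connect_root.
  have xT : x \in T.
    rewrite inE /x root_root // eqxx andbT; apply: (subsetP (comp_sub uA)).
    by rewrite inE.
  have [_ _ KE sK] := HK x.
  have ul : u \in x :: labels (K x) by rewrite -KE inE a_csym.
  by case: (sK _ _ ul uv) => h; [left|right]; apply/tF; exists x.
have sA : #|A| = size (tpairs F) by rewrite -EF card_Eof.
have sT : size (roots F) = #|T| by rewrite roots_mk -map_comp size_map -cardE.
have sK x : size (labels (K x)) = (#|comp x|).-1.
  by have [_ UK KE _] := HK x; rewrite (eq_card KE) (card_uniqP UK).
have nF : nontrivial F.
  rewrite /nontrivial; have -> : unmk F = [seq (x, K x) | x <- enum T].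
    by rewrite /F; elim: (enum T) => //= x l ->.
  rewrite all_map; apply/allP => x; rewrite mem_enum => /TA/comp_gt1 /=.
  by rewrite sK; case: #|_| => // -[].
have sL := size_tpairs F.
exists (size (labels F)), #|T|; split.
- by rewrite -sL sA sT.
- have := nontrivial_size nF; rewrite -sL -addnn leq_add2l sT sA; exact.
- by rewrite -(card_uniqP UF) -[leqRHS]card_ord max_card.
pose W := [set y in labels F].
have cW : #|W| = size (labels F) by rewrite cardsE; apply/card_uniqP.
apply: (@le_trans _ _ (#|partial (adj A) (adj H) W| * (n - size (labels F))`!)%:R).
  by rewrite ler_nat -cW -[n in (n - _)%N]card_ord card_embeddings_le.
rewrite natrM ler_wpM2r ?ler0n //.
have WE : W = \bigcup_(x in T) comp x.
  apply/setP => y; rewrite inE labels_mk -map_comp; apply/flatten_mapP/bigcupP => -[x].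
    by rewrite mem_enum => xT /= yx; exists x => //; have [_ _ -> _] := HK x.
  by move=> xT; have [_ _ -> _] := HK x => yx; exists x; rewrite ?mem_enum.
have -> : #|A| = (\sum_(x in T) (#|comp x|).-1)%N.
  rewrite sA; have := size_tpairs F; rewrite sT size_mk_enum.
  rewrite (eq_bigr (fun x => 1 + (#|comp x|).-1)%N); last by move=> x _; rewrite sK.
  by rewrite big_split /= sum1_card addnC => /addnI.
rewrite WE -prodr_const -prodrXr -big_split /=.
apply: (@le_trans _ _ (\prod_(x in T) #|partial (adj A) (adj H) (comp x)|%:R)); last first.
  by apply: ler_prod => x /TA xA; rewrite ler0n card_partial_comp.
rewrite -natr_prod ler_nat.
elim/big_rec2: _ => [|x m B _ IH].
  rewrite -(cards1 (restr set0 (id : 'I_n -> 'I_n))); apply: subset_leq_card.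
  apply/subsetP => g /imsetP[s _ ->]; rewrite inE; apply/eqP/ffunP => y.
  by rewrite !ffunE in_set0.
by apply: leq_trans (card_partialU _ _ _ _) _; rewrite leq_mul2l IH orbT.
Qed.

End Fixed.

End Spread.

Theorem theorem1p3 (R : realType) :
  exists2 C : R, 0 < C &
    forall (n : nat) (H : graph n), H != set0 -> is_tree H ->
      spread (C * q R H) (nu R H).
Proof.
(* The 16 comes from [4 ^ w] with [w <= 2 * #|A|], the 8 from [scale], and the rest from the
   component bound. *)
exists (16 * (132 * (160 * (4 * 8)))); first by rewrite !mulr_gt0.
move=> n H H0 [Hc Ha] A A0; rewrite pr_nu.
have q0 := q_gt0 R H0.
have [->|[t te]] := set_0Vmem (embeddings (adj A) (adj H)).
  by rewrite cards0 mul0r exprn_ge0 // mulr_ge0 ?(ltW q0) // !mulr_ge0.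
have [w [c [wE cA wn]]] := card_embeddings_bound R H0 Ha Hc te.
set D := 132 * _ => embE.
have nf : 0 < n`!%:R :> R by rewrite ltr0n fact_gt0.
have n0 : 0 < n%:R :> R by rewrite ltr0n (n_gt0 H0).
have D0 : 0 < D by rewrite /D !mulr_gt0 // (scale_gt0 R H0).
rewrite ler_pdivrMr //; apply: le_trans embE _.
rewrite -(ffact_fact wn) natrM [leRHS]mulrA ler_wpM2r ?ler0n //.
have := expn_le_ffact4 wn; rewrite -(ler_nat R) natrM !natrX.
rewrite {1}wE exprD => fE.
have w2 : 4 ^+ w <= 16 ^+ #|A| :> R.
  have -> : 16 = 4 ^+ 2 :> R by ring.
  by rewrite -exprM ler_weXn2l ?ler1n // mul2n -addnn wE leq_add2l.
(* As [w = #|A| + c], the extra power of [n] completes [n ^ c] to [n ^ w], and on the right it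
   supplies the [n] contained in [scale]. *)
rewrite -(@ler_pM2l _ (n%:R ^+ #|A|)) ?exprn_gt0 //.
apply: (@le_trans _ _ (D ^+ #|A| * (4 ^+ w * (n ^_ w)%:R))).
  rewrite [leLHS]mulrA [leLHS]mulrC; apply: ler_wpM2l => //; exact/exprn_ge0/ltW.
rewrite [leLHS]mulrA [leRHS]mulrA; apply: ler_wpM2r; first exact: ler0n.
apply: (@le_trans _ _ (D ^+ #|A| * 16 ^+ #|A|)).
  by apply: ler_wpM2l => //; exact/exprn_ge0/ltW.
rewrite -!exprMn le_eqVlt; apply/orP; left; apply/eqP; congr (_ ^+ _).
by rewrite /D /scale; ring.
Qed.
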